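(* Let $n\ge 1$ be an integer and $q$ a prime power, and suppose that $n\not\equiv 2\pmod 4$ or $q\not\equiv 3\pmod 4$. Then the total number of real conjugacy classes in $SL_n(q)$ is equal to $$\sum_{|\nu|=n}h_\nu\, sl_\nu,$$ where the sum runs over all partitions $\nu$ of $n$. Furthermore, provided $n\not\equiv 2\pmod 4$ or $q$ is even, this is the same as the total number of strongly real conjugacy classes in $SL_n(q)$.
   Context: An element $g$ of a group $G$ is real if $hgh^{-1}=g^{-1}$ for some $h\in G$, and strongly real if $h$ can be chosen with $h^2=1$; a class is (strongly) real if its elements are. A partition $\nu=\{\nu_1,\dots,\nu_r\}$ of $n$ (parts $\nu_j\ge1$ with sum $|\nu|=n$) is also written $\nu=1^{n_1}2^{n_2}\cdots$, where $n_i$ is the number of parts equal to $i$. Put $h_\nu=\gcd(q-1,\nu_1,\dots,\nu_r)$. For $d\ge 1$: $n_{q,d}=2q^{(d-1)/2}$ if $q$ odd, $d$ odd; $n_{q,d}=(q+1)q^{d/2-1}$ if $q$ odd, $d$ even; $n_{q,d}=q^{(d-1)/2}$ if $q$ even, $d$ odd; $n_{q,d}=q^{d/2}$ if $q$ even, $d$ even. The number $sl_\nu$ is defined by: - $sl_\nu=\prod_{n_i>0}n_{q,n_i}$ if $q$ is even or $n_i=0$ for all odd $i$; - $sl_\nu=\frac12\prod_{n_i>0}n_{q,n_i}$ if $q$ is odd and there exists $i$ with $i n_i$ odd; - $sl_\nu=f_\nu(q)\prod_{i\text{ odd},\,n_i>0}q^{n_i/2-1}\prod_{i\text{ even},\,n_i>0}n_{q,n_i}$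 otherwise, where $f_\nu(q)=\frac{(q+1)^r+(q-1)^r}{2}$ and $r$ here is the number of odd $i$ with $n_i>0$. *)

(* Defs.v *)
From HB Require Import structures.
From mathcomp Require Import all_boot all_order all_algebra all_fingroup.

Set Implicit Arguments.
Unset Strict Implicit.
Unset Printing Implicit Defensive.

Import GRing.Theory.
Local Open Scope nat_scope.

Section Real.
Variables (gT : finGroupType) (G : {group gT}).

(* [h * g * h^-1] is written out because mathcomp's [g ^ h] is [h^-1 * g * h]. *)
Definition real_elt (g : gT) : bool :=
  [exists h in G, (h * g * h^-1 == g^-1)%g].

Definition strongly_real_elt (g : gT) : bool :=
  [exists h in G, (h ^+ 2 == 1)%g && (h * g * h^-1 == g^-1)%g].

Definition real_classes : {set {set gT}} :=
  [set C in classes G | [forall g in C, real_elt g]].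

Definition strongly_real_classes : {set {set gT}} :=
  [set C in classes G | [forall g in C, strongly_real_elt g]].

End Real.

(* [{'GL_n[F]}] consists of matrices of size [n.-1.+1], so [n] is meant to be
   positive. *)
Definition SLset (n : nat) (F : finFieldType) : {set {'GL_n[F]}} :=
  [set g : {'GL_n[F]} | (\det (GLval g) == 1)%R].

Lemma SLset_group_set n F : group_set (SLset n F).
Proof.
apply/group_setP; split=> [|x y]; first by rewrite inE GL_1E det1.
by rewrite !inE GL_MxE det_mulmx => /eqP-> /eqP->; rewrite mulr1.
Qed.

Canonical SL (n : nat) (F : finFieldType) : {group {'GL_n[F]}} :=
  Group (SLset_group_set n F).

Definition is_partition (n : nat) (s : seq nat) : bool :=
  [&& sorted geq s, all (ltn 0) s & sumn s == n].

(* A partition of [n] has at most [n] parts, each at most [n]; the finite type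
   [n.-bseq 'I_n.+1] therefore contains all of them (see [partition_partsP]). *)
Definition parts (n : nat) (nu : n.-bseq 'I_n.+1) : seq nat :=
  map (@nat_of_ord n.+1) nu.

Lemma parts_inj n : injective (@parts n).
Proof. by move=> s t /(inj_map (@ord_inj _)) /val_inj. Qed.

Lemma partition_partsP n s :
  is_partition n s -> exists nu : n.-bseq 'I_n.+1, parts nu = s.
Proof.
case/and3P=> _ s_gt0 /eqP sum_s.
have size_s : size s <= n.
  rewrite -sum_s {sum_s}; elim: s s_gt0 => //= x s IHs /andP[x_gt0 /IHs le_s].
  by rewrite -add1n leq_add.
have s_ltn x : x \in s -> x < n.+1.
  rewrite ltnS -sum_s {sum_s size_s s_gt0}; elim: s => //= y s IHs.
  rewrite inE => /predU1P[->|/IHs le_x]; first exact: leq_addr.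
  exact: leq_trans le_x (leq_addl _ _).
have size_t : size (map (@inord n) s) <= n by rewrite size_map.
exists (Bseq size_t); rewrite /parts /= -map_comp map_id_in // => x /s_ltn.
exact: inordK.
Qed.

Definition nqd (q d : nat) : nat :=
  if odd q then
    if odd d then 2 * q ^ d.-1./2 else q.+1 * q ^ d./2.-1
  else
    if odd d then q ^ d.-1./2 else q ^ d./2.

Definition mult (s : seq nat) (i : nat) : nat := count_mem i s.

Definition hnu (q : nat) (s : seq nat) : nat := foldr gcdn q.-1 s.

Definition fnu (q : nat) (s : seq nat) : rat :=
  let r := count odd (undup s) in
  ((q.+1 ^ r + q.-1 ^ r)%:R / 2)%R.

(* [undup s] lists once each [i] of nonzero multiplicity.  In the last case
   every odd [i] has even multiplicity, so the exponent is exact. *)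
Definition slnu (q : nat) (s : seq nat) : rat :=
  if ~~ odd q || all (fun i => ~~ odd i) s then
    (\prod_(i <- undup s) (nqd q (mult s i))%:R)%R
  else if has (fun i => odd (i * mult s i)) s then
    (2^-1 * \prod_(i <- undup s) (nqd q (mult s i))%:R)%R
  else
    (fnu q s
     * (\prod_(i <- undup s | odd i) (q ^ (mult s i)./2.-1)%:R)
     * (\prod_(i <- undup s | ~~ odd i) (nqd q (mult s i))%:R))%R.

(* Main.v *)
Require Import Defs.
From mathcomp Require Import all_boot all_order all_algebra all_fingroup.
From mathcomp Require Import all_solvable all_field zify.
Import GRing.Theory.

Set Implicit Arguments.
Unset Strict Implicit.
Unset Printing Implicit Defensive.
Import Num.Theory.
Local Open Scope ring_scope.

(** A square matrix [A] over [F] is determined up to similarity by the ranks of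
    all the matrices [p(A)]: a cyclic block whose annihilator is the minimal
    polynomial splits off, and the ranks of the complement are known.  Hence the
    classes of GL_n correspond to sequences (u_1, ..., u_n) of monic polynomials
    with nonzero constant term and sum of i deg u_i equal to n, an irreducible f
    dividing u_i as often as f^i occurs among the elementary divisors; the class
    has type nu when n_i = deg u_i.  Inversion replaces each u_i by its
    reciprocal polynomial and the determinant is the product of the
    ((-1)^(n_i) u_i(0))^i, so the real classes of GL_n of determinant 1 and type
    nu correspond to sequences of self-reciprocal polynomials subject to a sign
    condition, and there are sl_nu of them.

    Such a class splits into [F^x : det C(A)] classes of SL_n, and det C(A) is
    the group of h_nu-th powers.  It contains all i-th powers for i in nu because
    norms of finite fields are surjective.  Conversely let N = P(A), P being the
    product of the distinct irreducible factors; if c commutes with A, then det c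
    is the product over j of the determinants of c on the spaces ker N /\ im N^j,
    and two consecutive spaces j - 1, j differ only if j occurs in nu.

    Finally a cyclic matrix with cyclic vector v, similar to its inverse, is
    reversed by the involution v A^j |-> v A^(-j).  Summing over blocks, one can
    prescribe the determinant 1 unless all blocks have even size and determinant
    1, when the determinant is (-1)^(n/2).  If n = 2 and q = 1 modulo 4, the
    remaining sign is corrected by an element of C(A) of determinant -1. *)

(** * Matrix polynomials, similarity and cyclic matrices *)

Section MatrixPolynomials.
Variable F : fieldType.
Implicit Types (p q a b : {poly F}) (n : nat).

(* [horner_mx] requires a size of the form [n.+1], but block decompositions also
   produce empty blocks. *)
Definition hmx n (A : 'M[F]_n) p : 'M_n :=
  (if n is n'.+1 then horner_mx^~ p : 'M_n'.+1 -> 'M_n'.+1 else fun=> 0) A.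

Lemma hmxE n (A : 'M[F]_n.+1) p : hmx A p = horner_mx A p.
Proof. by []. Qed.

Lemma hmx0 n (A : 'M[F]_n) : hmx A 0 = 0.
Proof. by case: n A => [|n] A; [rewrite !flatmx0 | rewrite hmxE rmorph0]. Qed.

Lemma hmxC n (A : 'M[F]_n) c : hmx A c%:P = c%:M.
Proof. by case: n A => [|n] A; [rewrite [RHS]flatmx0 | rewrite hmxE horner_mx_C]. Qed.

Lemma hmx1 n (A : 'M[F]_n) : hmx A 1 = 1%:M.
Proof. exact: hmxC. Qed.

Lemma hmxX n (A : 'M[F]_n) : hmx A 'X = A.
Proof. by case: n A => [|n] A; [rewrite [RHS]flatmx0 | rewrite hmxE horner_mx_X]. Qed.

Lemma hmxD n (A : 'M[F]_n) p q : hmx A (p + q) = hmx A p + hmx A q.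
Proof. by case: n A => [|n] A; [rewrite [RHS]flatmx0 | rewrite !hmxE rmorphD]. Qed.

Lemma hmxM n (A : 'M[F]_n) p q : hmx A (p * q) = hmx A p *m hmx A q.
Proof. by case: n A => [|n] A; [rewrite [RHS]flatmx0 | rewrite !hmxE rmorphM]. Qed.

Lemma hmxMC n (A : 'M[F]_n) p q : hmx A p *m hmx A q = hmx A q *m hmx A p.
Proof. by rewrite -!hmxM mulrC. Qed.

Lemma hmxXn n (A : 'M[F]_n) i p : hmx A (p ^+ i) = hmx A p ^+ i.
Proof. by elim: i => [|i IH]; rewrite ?hmx1 // !exprS hmxM IH. Qed.

(** [T] may be rectangular: a row basis of a stable subspace intertwines a matrix with its
    restriction, and a matrix commuting with [A] is the case [A = B]. *)
Lemma hmx_inter m n (T : 'M[F]_(m, n)) A B p :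
  T *m B = A *m T -> T *m hmx B p = hmx A p *m T.
Proof.
move=> TBA; elim/poly_ind: p => [|p c IH]; first by rewrite !hmx0 mulmx0 mul0mx.
rewrite !hmxD !hmxM !hmxX !hmxC mulmxDr mulmxDl mulmxA IH -!mulmxA TBA.
by rewrite scalar_mxC.
Qed.

Lemma hmx_block m n (A : 'M[F]_m) (B : 'M[F]_n) p :
  hmx (block_mx A 0 0 B) p = block_mx (hmx A p) 0 0 (hmx B p).
Proof.
elim/poly_ind: p => [|p c IH]; first by rewrite !hmx0 -block_mx0.
rewrite !hmxD !hmxM !hmxX !hmxC IH mulmx_block !(mulmx0, mul0mx, addr0, add0r).
by rewrite scalar_mx_block add_block_mx !addr0.
Qed.

(* The two sizes are provably equal, but keeping them syntactically different
   avoids casts between [k + m] and [n]. *)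
Definition sim m n (A : 'M[F]_m) (B : 'M[F]_n) :=
  exists T S, [/\ T *m S = 1%:M, S *m T = 1%:M & T *m B = A *m T].

Lemma sim_refl n (A : 'M[F]_n) : sim A A.
Proof. by exists 1%:M, 1%:M; rewrite !mulmx1 mul1mx. Qed.


Lemma sim_sym m n (A : 'M[F]_m) (B : 'M[F]_n) : sim A B -> sim B A.
Proof.
move=> [T [S [TS ST TB]]]; exists S, T; split=> //.
by rewrite -[LHS]mulmx1 -TS !mulmxA -(mulmxA S A T) -TB !mulmxA ST mul1mx.
Qed.

Lemma sim_trans m n k (A : 'M[F]_m) (B : 'M[F]_n) (C : 'M[F]_k) :
  sim A B -> sim B C -> sim A C.
Proof.
move=> [T [S [TS ST TB]]] [T' [S' [TS' ST' TB']]].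
exists (T *m T'), (S' *m S); split.
- by rewrite mulmxA -(mulmxA T) TS' mulmx1.
- by rewrite mulmxA -(mulmxA S') ST mulmx1.
- by rewrite -mulmxA TB' !mulmxA TB.
Qed.

Lemma sim_block m n m' n' (A : 'M[F]_m) (B : 'M[F]_n)
    (A' : 'M[F]_m') (B' : 'M[F]_n') :
  sim A B -> sim A' B' -> sim (block_mx A 0 0 A') (block_mx B 0 0 B').
Proof.
move=> [T [S [TS ST TB]]] [T' [S' [TS' ST' TB']]].
exists (block_mx T 0 0 T'), (block_mx S 0 0 S').
by rewrite !mulmx_block !(mulmx0, mul0mx, addr0, add0r) TS ST TB TS' ST' TB'
  -!scalar_mx_block.
Qed.

Lemma sim_rank m n (A : 'M[F]_m) (B : 'M[F]_n) p :
  sim A B -> \rank (hmx A p) = \rank (hmx B p).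
Proof.
have le_rk m' n' (C : 'M[F]_m') (D : 'M[F]_n') : sim C D ->
    (\rank (hmx C p) <= \rank (hmx D p))%N.
  move=> [T [S [TS ST TB]]].
  rewrite -[hmx C p]mulmx1 -TS mulmxA -(hmx_inter p TB) -mulmxA.
  exact: leq_trans (mxrankM_maxr _ _) (mxrankM_maxl _ _).
by move=> simAB; apply/eqP; rewrite eqn_leq !le_rk //; apply: sim_sym.
Qed.

Lemma sim_dim m n (A : 'M[F]_m) (B : 'M[F]_n) : sim A B -> m = n.
Proof. by move=> /(sim_rank 1); rewrite !hmx1 !mxrank1. Qed.

Lemma sim_unit n (A B : 'M[F]_n) : sim A B ->
  exists2 P, P \in unitmx & P *m B = A *m P.
Proof. by move=> [T [S [/mulmx1_unit[Tu _] _ TB]]]; exists T. Qed.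

Lemma unit_sim n (A B P : 'M[F]_n) : P \in unitmx -> P *m B = A *m P -> sim A B.
Proof. by move=> Pu PB; exists P, (invmx P); rewrite mulVmx ?mulmxV. Qed.

Lemma free_full_sim m n (A : 'M[F]_m) (B : 'M[F]_n) (T : 'M_(m, n)) :
  row_free T -> row_full T -> T *m B = A *m T -> sim A B.
Proof.
by move=> Tfree Tfull TB; exists T, (pinvmx T); rewrite mulmxVp // mulVpmx.
Qed.

Lemma hmxZ n (A : 'M[F]_n) c p : hmx A (c *: p) = c *: hmx A p.
Proof. by rewrite -mul_polyC hmxM hmxC mul_scalar_mx. Qed.

Lemma hmx_sum n (A : 'M[F]_n) I (r : seq I) (P : pred I) (E : I -> {poly F}) :
  hmx A (\sum_(i <- r | P i) E i) = \sum_(i <- r | P i) hmx A (E i).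
Proof. exact: (big_morph _ (hmxD A) (hmx0 A)). Qed.

(** Multiplying a row of coefficients by this matrix evaluates the polynomial at [A] and applies it
    to [v], so linear relations between the rows are polynomials of size at most [d] annihilating
    [v]. *)
Definition krylov n (v : 'rV[F]_n) (A : 'M_n) d := \matrix_(i < d) (v *m A ^+ i).

Lemma mul_krylov n (v : 'rV[F]_n) (A : 'M_n) d (u : 'rV_d) :
  u *m krylov v A d = v *m hmx A (rVpoly u).
Proof.
rewrite mulmx_sum_row /rVpoly poly_def hmx_sum mulmx_sumr; apply: eq_bigr => i _.
by rewrite rowK valK hmxZ hmxXn hmxX scalemxAr.
Qed.

Lemma poly_krylov n (v : 'rV[F]_n) (A : 'M_n) d p : (size p <= d)%N ->
  poly_rV p *m krylov v A d = v *m hmx A p.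
Proof. by move=> pd; rewrite mul_krylov poly_rV_K. Qed.

(* Multiplication by ['X] on [{poly F} / (a)], in the basis of the powers of ['X]. *)
Definition shiftmx k (a : {poly F}) : 'M_k := \matrix_(i < k) poly_rV ('X^(i.+1) %% a).

Lemma krylov_shift n (v : 'rV[F]_n) (A : 'M_n) k a :
  size a = k.+1 -> v *m hmx A a = 0 ->
  krylov v A k *m A = shiftmx k a *m krylov v A k.
Proof.
move=> sz_a va; apply/row_matrixP => i; rewrite !row_mul !rowK.
have a0 : a != 0 by rewrite -size_poly_gt0 sz_a.
rewrite poly_krylov; last by rewrite -ltnS -sz_a ltn_modp.
have -> : v *m A ^+ i *m A = v *m hmx A 'X^(i.+1).
  by rewrite -mulmxA hmxXn hmxX exprSr.
rewrite {1}(divp_eq 'X^(i.+1) a) hmxD mulmxDr hmxM hmxMC.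
by rewrite mulmxA va mul0mx add0r.
Qed.

(** Row vectors form a module over [{poly F}] through [A]; here [v] generates it and identifies it
    with the quotient by [a]. *)
Definition cyc_vec k (A : 'M[F]_k) a (v : 'rV_k) :=
  [/\ a \is monic, size a = k.+1, v *m hmx A a = 0 & krylov v A k \in unitmx].

Definition cyc k (A : 'M[F]_k) a := exists v, cyc_vec A a v.

Section CycVec.
Variables (k : nat) (A : 'M[F]_k) (a : {poly F}) (v : 'rV[F]_k).
Hypothesis Aav : cyc_vec A a v.

Lemma cyc_vec_surj w : exists2 p : {poly F}, (size p <= k)%N & w = v *m hmx A p.
Proof.
case: Aav => _ _ _ Ku; exists (rVpoly (w *m invmx (krylov v A k))).
  exact: size_poly.
by rewrite -mul_krylov mulmxKV.
Qed.

Lemma cyc_hmx0 : hmx A a = 0.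
Proof.
apply/row_matrixP => i; rewrite row0 rowE.
have [p _ ->] := cyc_vec_surj (delta_mx 0 i).
by case: Aav => _ _ va _; rewrite -mulmxA hmxMC mulmxA va mul0mx.
Qed.

(** The remainder of [p] modulo [a] has size at most [k] and acts on [v] as [p] does; as the Krylov
    rows are independent, it kills [v] only if it is 0. *)
Lemma cyc_vec_dvd p : (v *m hmx A p == 0) = (a %| p).
Proof.
case: Aav => mon sz va Ku.
have a0 : a != 0 by rewrite -size_poly_gt0 sz.
apply/eqP/idP => [vp | /dvdpP[q ->]]; last by rewrite hmxM cyc_hmx0 !mulmx0.
have szm : (size (p %% a)%R <= k)%N by rewrite -ltnS -sz ltn_modp.
have: v *m hmx A (p %% a) = 0.
  move: vp; rewrite {1}(divp_eq p a) hmxD mulmxDr hmxM hmxMC mulmxA va mul0mx.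
  by rewrite add0r.
rewrite -(poly_krylov _ _ szm) => /(congr1 (mulmx^~ (invmx (krylov v A k)))).
rewrite mulmxK // mul0mx => /(congr1 rVpoly); rewrite poly_rV_K // raddf0.
by rewrite /dvdp => ->.
Qed.

Lemma cyc_dvd p : (hmx A p == 0) = (a %| p).
Proof.
apply/eqP/idP => [h | /dvdpP[q ->]]; last by rewrite hmxM cyc_hmx0 !mulmx0.
by rewrite -cyc_vec_dvd h mulmx0.
Qed.

Lemma cyc_shift : sim (shiftmx k a) A.
Proof.
by case: Aav => mon sz va Ku; apply: unit_sim (Ku) _; apply: krylov_shift.
Qed.

(* If [a = d * m], then [d(A)] has rank at least [deg m], [m(A)] has rank at
   least [deg d], and [d(A) *m m(A) = 0]. *)
Lemma cyc_rank p : \rank (hmx A p) = (k - (size (gcdp p a)).-1)%N.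
Proof.
case: (Aav) => mon sz va Ku.
have a0 : a != 0 by rewrite -size_poly_gt0 sz.
have rk_ge d m : d * m = a -> ((size m).-1 <= \rank (hmx A d))%N.
  move=> dm.
  have d0 : d != 0 by apply: contraNneq a0 => d0; rewrite -dm d0 mul0r.
  have m0 : m != 0 by apply: contraNneq a0 => m0; rewrite -dm m0 mulr0.
  pose B := krylov (v *m hmx A d) A (size m).-1.
  have Bfree : row_free B.
    apply/inj_row_free => u; rewrite mul_krylov -mulmxA -hmxM => /eqP.
    rewrite cyc_vec_dvd -dm dvdp_mul2l // => mdvd.
    apply: (can_inj rVpolyK); rewrite raddf0; apply: contraTeq mdvd => u0.
    apply/negP => /dvdp_leq => /(_ u0); rewrite leqNgt.
    by rewrite (leq_ltn_trans (size_poly _ _)) // ltn_predL size_poly_gt0.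
  rewrite -[X in (X <= _)%N](eqP Bfree); apply: mxrankS.
  apply/row_subP => i; rewrite rowK -mulmxA -[A in A ^+ i]hmxX -hmxXn hmxMC.
  by rewrite mulmxA submxMl.
set d := gcdp p a.
have [m am] : exists m, a = m * d by apply/dvdpP/dvdp_gcdr.
have d0 : d != 0 by apply: contraNneq a0 => d0; rewrite am d0 mulr0.
have m0 : m != 0 by apply: contraNneq a0 => m0; rewrite am m0 mul0r.
have szE : ((size d).-1 + (size m).-1)%N = k.
  have := sz; rewrite am size_mul //.
  by rewrite -[size d]prednK ?size_poly_gt0 // -[size m]prednK ?size_poly_gt0 //
    addSn addnS /= => -[<-]; rewrite addnC.
have -> : \rank (hmx A p) = \rank (hmx A d).
  apply/eqP; rewrite eqn_leq; apply/andP; split.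
    have /dvdpP[q ->] : d %| p by apply: dvdp_gcdl.
    by rewrite hmxM mxrankM_maxr.
  have [[u w] /= E] := Bezoutp p a.
  have /dvdpP[q dE] : u * p + w * a %| d by rewrite (eqp_dvdl _ E).
  rewrite dE hmxM (leq_trans (mxrankM_maxr _ _)) //.
  by rewrite hmxD !hmxM cyc_hmx0 mulmx0 addr0 mxrankM_maxr.
have dm0 : (\rank (hmx A m) + \rank (hmx A d) <= k)%N.
  by apply: mulmx0_rank_max; rewrite -hmxM -am cyc_hmx0.
have rm := rk_ge m d (esym am); have rd := rk_ge d m (etrans (mulrC _ _) (esym am)).
move: (\rank (hmx A m)) (\rank (hmx A d)) (size d).-1 (size m).-1 dm0 rd rm szE.
by move=> x y z t; lia.
Qed.
End CycVec.

Lemma cyc_sim m n (A : 'M[F]_m) (B : 'M[F]_n) a : cyc A a -> cyc B a -> sim A B.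
Proof.
move=> [v Av] [w Bw]; have szA := Av; have szB := Bw.
case: szA szB => _ szA _ _ [_ szB _ _].
have mn : m = n by move: szB; rewrite szA => -[].
by case: n / mn B w Bw {szB} => B w /cyc_shift; apply/sim_trans/sim_sym/cyc_shift/Av.
Qed.

Lemma rVpoly_shift k a p : size a = k.+1 -> (size p <= k)%N ->
  poly_rV p *m shiftmx k a = poly_rV ((p * 'X) %% a).
Proof.
move=> sz pk; rewrite mulmx_sum_row -[in RHS](poly_rV_K pk) /rVpoly poly_def.
have modp_sum I (r : seq I) (E : I -> {poly F}) :
    (\sum_(i <- r) E i) %% a = \sum_(i <- r) (E i %% a).
  by apply: (big_morph (fun p => p %% a)) => [x y|]; rewrite ?modpD ?mod0p.
rewrite mulr_suml modp_sum linear_sum; apply: eq_bigr => i _.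
by rewrite rowK valK -scalerAl -exprSr modpZl linearZ.
Qed.

Lemma cyc_shiftmx k a : a \is monic -> size a = k.+1 -> cyc (shiftmx k a) a.
Proof.
move=> mon sz; have a0 : a != 0 by apply: monic_neq0.
(* The class of the constant 1 generates the quotient by [a]. *)
pose v : 'rV[F]_k := poly_rV 1.
have vp p : v *m hmx (shiftmx k a) p = poly_rV (p %% a).
  elim/poly_ind: p => [|p c IH]; first by rewrite hmx0 mod0p mulmx0 raddf0.
  rewrite hmxD hmxM hmxX hmxC mulmxDr mulmxA IH rVpoly_shift //; last first.
    by rewrite -ltnS -sz ltn_modp.
  rewrite modpD mul_mx_scalar !linearD /=; congr (_ + _).
    by rewrite mulrC modp_mul mulrC.
  case: k sz @v IH => [|k] sz v IH; first by rewrite !thinmx0.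
  rewrite -linearZ -alg_polyC modp_small // sz.
  by rewrite (leq_ltn_trans (size_scale_leq _ _)) // size_poly1.
exists v; split=> //; first by rewrite vp modpp raddf0.
rewrite [krylov _ _ _](_ : _ = 1%:M) ?unitmx1 //.
apply/row_matrixP => i; rewrite rowK -[A in v *m A ^+ _]hmxX -hmxXn vp.
rewrite modp_small ?size_polyXn ?sz ?ltnS //.
by apply/rowP => j; rewrite !mxE coefXn eq_sym.
Qed.

Lemma exists_cyc a : a \is monic -> exists A : 'M_((size a).-1), cyc A a.
Proof.
move=> mon; exists (shiftmx _ a); apply: cyc_shiftmx => //.
by rewrite prednK // size_poly_gt0 monic_neq0.
Qed.

End MatrixPolynomials.

(** * Cyclic decomposition *)

Section Irreducible.
Variable F : finFieldType.
Implicit Types (p q a b d f : {poly F}).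

Lemma split_power f p : (1 < size f)%N -> p != 0 ->
  exists k q, p = f ^+ k * q /\ ~~ (f %| q).
Proof.
move=> f1; move: {2}(size p) (leqnn (size p)) => m; elim: m p => [|m IH] p.
  by rewrite leqn0 size_poly_eq0 => ->.
move=> szp p0; case: (boolP (f %| p)) => [/dvdpP[q pE]|fp]; last first.
  by exists 0, p; rewrite mul1r.
have q0 : q != 0 by apply: contraNneq p0 => q0; rewrite pE q0 mul0r.
have f0 : f != 0 by rewrite -size_poly_gt0 ltnW.
have szq : (size q <= m)%N.
  by move: szp f1; rewrite pE size_mul // -!subn1; move: (size q) (size f) => x y; lia.
have [k [r [qE fr]]] := IH q szq q0.
by exists k.+1, r; split=> //; rewrite pE qE exprS [LHS]mulrC mulrA.
Qed.

Lemma irred_factor p : (1 < size p)%N ->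
  exists f, [/\ irreducible_poly f, f \is monic & f %| p].
Proof.
move: {2}(size p) (leqnn (size p)) => m; elim: m p => [|m IH] p.
  by rewrite leqn0 => /eqP->.
move=> szp p1; case: (irreducibleP p) => irr.
  have lc0 : lead_coef p != 0 by rewrite lead_coef_eq0 irredp_neq0.
  have pE : (lead_coef p)^-1 *: p %= p by rewrite eqp_scale // invr_eq0.
  exists ((lead_coef p)^-1 *: p); split.
  - split; first by rewrite size_scale ?invr_eq0.
    by move=> q q1; rewrite (eqp_dvdr _ pE) (eqp_rtrans pE) => /irr; apply.
  - by rewrite monicE lead_coefZ mulVf.
  - by case/andP: pE.
have /existsP[q] : [exists q : {poly_((size p).-1) F},
    ~~ (Pdiv.CommonRing.rdvdp q p ==> (size q <= 1)%N)].
  by rewrite -negb_forall; apply/negP=> all_q; apply: irr; apply/irreducibleP/andP.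
rewrite negb_imply -Pdiv.Idomain.dvdpE -ltnNge => /andP[qp q1].
have szq : (size q <= m)%N.
  by rewrite (leq_trans (size_npoly q)) // -ltnS (leq_trans _ szp) // ltn_predL ltnW.
have [f [irrf monf fq]] := IH _ szq q1.
by exists f; split=> //; apply: dvdp_trans fq qp.
Qed.

(** Up to units, the divisors of a power of [f] are the smaller powers of [f]. *)
Lemma irred_dvd_exp f d k : irreducible_poly f -> d %| f ^+ k.+1 ->
  f ^+ k.+1 %| d \/ d %| f ^+ k.
Proof.
move=> irr; have f0 := irredp_neq0 irr.
elim: k d => [|k IH] d df; case: (boolP (f %| d)) => [/dvdpP[e dE]|fd]; last first.
- right; move: df; rewrite exprS Gauss_dvdpr // coprimep_sym.
  by rewrite irreducible_poly_coprime.
- move: df; rewrite dE [in _ %| _ ^+ _]mulrC exprS dvdp_mul2l // => /IH[fe|ef].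
    by left; rewrite [e * f]mulrC dvdp_mul2l.
  by right; rewrite [e * f]mulrC exprS dvdp_mul2l.
- right; move: df; rewrite exprS Gauss_dvdpr // coprimep_sym.
  by rewrite irreducible_poly_coprime.
- by left.
Qed.

End Irreducible.

Section Cyclic.
Variable F : finFieldType.
Implicit Types (p q a b d f : {poly F}).

Lemma ann_dvd n (A : 'M[F]_n) (v : 'rV_n) p q :
  v *m hmx A p = 0 -> p %| q -> v *m hmx A q = 0.
Proof. by move=> vp /dvdpP[r ->]; rewrite mulrC hmxM mulmxA vp mul0mx. Qed.

Lemma ann_gcd n (A : 'M[F]_n) (v : 'rV_n) p q :
  v *m hmx A p = 0 -> v *m hmx A q = 0 -> v *m hmx A (gcdp p q) = 0.
Proof.
move=> vp vq; have [[x y] /= E] := Bezoutp p q.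
apply: (@ann_dvd _ _ _ (x * p + y * q)); last by rewrite (eqp_dvdl _ E).
by rewrite hmxD mulmxDr (ann_dvd vp) ?(ann_dvd vq) ?addr0 // dvdp_mull.
Qed.

(** Induction on [b]. Write [b = f^(k+1) c] with [f] irreducible and prime to [c], and the minimal
    polynomial as [g f^(k+1)]. By minimality [g f^k] does not kill the whole space, so some [w g(A)]
    has annihilator exactly [f^(k+1)]. Adding a vector with annihilator [c] gives annihilator [b],
    because the two are coprime. *)
Lemma exists_annihilator n (A : 'M[F]_n.+1) b : b %| mxminpoly A ->
  exists v : 'rV_n.+1, forall p, (v *m hmx A p == 0) = (b %| p).
Proof.
have a0 : mxminpoly A != 0 by rewrite monic_neq0 ?mxminpoly_monic.
move: {2}(size b) (leqnn (size b)) => m; elim: m b => [|m IH] b.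
  by rewrite leqn0 size_poly_eq0 => /eqP->; rewrite dvd0p => /eqP a00; rewrite a00 eqxx in a0.
move=> szb ba; have b0 : b != 0 by apply: contraTneq ba => ->; rewrite dvd0p.
case: (leqP (size b) 1) => [b1|b1].
  exists 0 => p; rewrite mul0mx eqxx; symmetry.
  have /eqP/size_poly1P[c c0 ->] : size b = 1%N.
    by apply/eqP; rewrite eqn_leq b1 size_poly_gt0.
  by rewrite -alg_polyC dvdpZl // dvd1p.
have [f [irr mon fb]] := irred_factor b1.
have f0 := irredp_neq0 irr; have f1 : (1 < size f)%N by case: irr.
have [[|k] [c [bE fc]]] := split_power f1 b0.
  by move: fc; rewrite bE mul1r in fb *; rewrite fb.
have cfk j : coprimep (f ^+ j) c.
  by rewrite coprimep_expl // irreducible_poly_coprime.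
have c0 : c != 0 by apply: contraNneq b0 => c0; rewrite bE c0 mulr0.
have cb : c %| b by rewrite bE dvdp_mull.
have [v2 v2P] : exists v : 'rV_n.+1, forall p, (v *m hmx A p == 0) = (c %| p).
  apply: IH (dvdp_trans cb ba).
  have fkc0 : f ^+ k * c != 0 by rewrite mulf_neq0 ?expf_neq0.
  have: (size c <= size (f ^+ k * c)%R)%N by rewrite dvdp_leq ?dvdp_mull.
  move: szb f1; rewrite bE exprS -mulrA size_mul // -subn1.
  by move: (size f) (size c) (size (f ^+ k * c)%R) => x y z; lia.
have /dvdpP[g aE] : f ^+ k.+1 %| mxminpoly A by apply: dvdp_trans ba; rewrite bE dvdp_mulr.
have [w wP] : exists w : 'rV_n.+1, w *m hmx A (g * f ^+ k) != 0.
  have : hmx A (g * f ^+ k) != 0.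
    rewrite hmxE -dvd_mxminpoly aE exprS mulrCA.
    rewrite -[X in _ %| X]mul1r dvdp_mul2r ?dvdp1 ?gtn_eqF //.
    apply: contraNneq a0 => gf0; by rewrite aE exprS mulrCA gf0 mulr0.
  by case/rowV0Pn=> w /submxP[u ->] uA0; exists u.
pose v1 := w *m hmx A g.
have v1f : v1 *m hmx A (f ^+ k.+1) = 0.
  by rewrite -mulmxA -hmxM -aE hmxE mx_root_minpoly mulmx0.
have v1P p : (v1 *m hmx A p == 0) = (f ^+ k.+1 %| p).
  apply/idP/idP => [/eqP v1p|/(ann_dvd v1f)/eqP//].
  have [fd|df] := irred_dvd_exp irr (dvdp_gcdr p (f ^+ k.+1)).
    by apply: dvdp_trans fd (dvdp_gcdl _ _).
  case/negP: wP; rewrite hmxM mulmxA; apply/eqP; apply: ann_dvd df.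
  exact: ann_gcd v1p _.
exists (v1 + v2) => p; rewrite mulmxDl bE.
apply/eqP/idP => [/eqP v12|]; last first.
  rewrite Gauss_dvdp // -v1P -v2P => /andP[/eqP-> /eqP->].
  by rewrite addr0.
rewrite Gauss_dvdp //; apply/andP; split.
  have: f ^+ k.+1 %| p * c; last by rewrite Gauss_dvdpl.
  rewrite -v1P hmxM mulmxA; move: v12; rewrite addr_eq0 => /eqP->.
  by rewrite mulNmx -mulmxA -hmxM oppr_eq0 v2P dvdp_mull.
have: c %| p * f ^+ k.+1; last by rewrite Gauss_dvdpl // coprimep_sym.
rewrite -v2P hmxM mulmxA; move: v12; rewrite addrC addr_eq0 => /eqP->.
by rewrite mulNmx -mulmxA -hmxM oppr_eq0 v1P dvdp_mull.
Qed.

Lemma hmx_tr n (A : 'M[F]_n) p : hmx A^T p = (hmx A p)^T.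
Proof.
elim/poly_ind: p => [|p c IH]; first by rewrite !hmx0 trmx0.
by rewrite [p * 'X in LHS]mulrC !hmxD !hmxM !hmxX !hmxC linearD /= trmx_mul tr_scalar_mx IH.
Qed.

Lemma col_krylov n (A : 'M[F]_n) (w : 'cV_n) k (j : 'I_k) :
  col j (krylov w^T A^T k)^T = A ^+ j *m w.
Proof.
rewrite -tr_row rowK -[A^T]hmxX -hmxXn hmx_tr -trmx_mul trmxK.
by rewrite hmxXn hmxX.
Qed.

Lemma krylov_free n (A : 'M[F]_n) (v : 'rV_n) k a :
  size a = k.+1 -> (forall p, (v *m hmx A p == 0) = (a %| p)) ->
  row_free (krylov v A k).
Proof.
move=> sz vP; apply/inj_row_free => u; rewrite mul_krylov => /eqP.
rewrite vP => ap; apply: (can_inj rVpolyK); rewrite raddf0.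
apply/eqP; apply: contraTT ap => u0; apply/negP => /dvdp_leq => /(_ u0).
by rewrite sz ltnNge size_poly.
Qed.

(* The product is a Hankel matrix with ones on the antidiagonal and zeros above it. *)
Lemma hankel_unit n (A : 'M[F]_n) (v : 'rV_n) (w : 'cV_n) k a :
  size a = k.+1 -> v *m hmx A a = 0 ->
  (forall j, (j < k)%N -> (v *m A ^+ j *m w) 0 0 = (j.+1 == k)%:R) ->
  krylov v A k *m (krylov w^T A^T k)^T \in unitmx.
Proof.
move=> sz va vw; rewrite -row_free_unit; apply/inj_row_free => u.
rewrite mulmxA mul_krylov => u0.
have a0 : a != 0 by rewrite -size_poly_gt0 sz.
set p := rVpoly u in u0.
have pj j : (j < k)%N -> v *m hmx A (p * 'X^j) *m w = 0.
  move=> jk; have := congr1 (col (Ordinal jk)) u0.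
  by rewrite colE -mulmxA -colE col_krylov matrix.col0 hmxM hmxXn hmxX !mulmxA.
have vwp q : (size q <= k)%N -> (v *m hmx A q *m w) 0 0 = q`_k.-1.
  move=> qk; rewrite -[in LHS](coefK q) poly_def hmx_sum mulmx_sumr mulmx_suml summxE.
  transitivity (\sum_(i < size q) q`_i * (i.+1 == k)%:R).
    apply: eq_bigr => i _; rewrite hmxZ hmxXn hmxX -scalemxAr -scalemxAl mxE vw //.
    exact: leq_trans (ltn_ord i) qk.
  case: (leqP (size q) k.-1) => [qk1|kq].
    rewrite nth_default // big1 // => i _; case: eqP => ik; rewrite ?mulr0 //.
    by move: (leq_trans (ltn_ord i) qk1); rewrite -ik ltnn.
  rewrite (bigD1 (Ordinal kq)) //= prednK; last by case: (k) kq qk; case: size.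
  rewrite eqxx mulr1 big1 ?addr0 // => i; rewrite -val_eqE /=.
  by move=> ik; case: eqP; rewrite ?mulr0 // => ki; rewrite -ki eqxx in ik.
apply: (can_inj rVpolyK); rewrite raddf0 -/p; apply/eqP; case: (eqVneq p 0) => // p0.
have pk : (size p <= k)%N := size_poly _ _.
have sp : (0 < size p)%N by rewrite size_poly_gt0.
have szp : size (p * 'X^(k - size p)) = k.
  by rewrite size_mulXn // subnK.
have kp : (k - size p < k)%N by lia.
have := vwp (p * 'X^(k - size p)); rewrite szp leqnn pj // => /(_ isT).
rewrite mxE => lc0; have /eqP : lead_coef (p * 'X^(k - size p)) = 0.
  by rewrite /lead_coef szp -lc0.
by rewrite lead_coef_eq0 -size_poly_eq0 szp; case: (k) pk sp => //; case: size.
Qed.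

(* With [v] annihilated exactly by the multiples of the minimal polynomial and [w]
   a functional dual to the last of the [v A^j], the common kernel of the
   functionals [A^j w] is a stable complement of the cyclic subspace of [v]. *)
Lemma cyclic_block n (A : 'M[F]_n.+1) :
  exists k (C : 'M_k) m (A' : 'M_m), [/\ (0 < k)%N, cyc C (mxminpoly A) &
    sim (block_mx C 0 0 A') A].
Proof.
pose k := degree_mxminpoly A; set a := mxminpoly A.
have k_gt0 : (0 < k)%N := mxminpoly_nonconstant A.
have sz : size a = k.+1 := size_mxminpoly A.
have mon : a \is monic := mxminpoly_monic A.
have aA : hmx A a = 0 by rewrite hmxE mx_root_minpoly.
have [v vP] := exists_annihilator (dvdpp a).
have va : v *m hmx A a = 0 by apply/eqP; rewrite vP.
have Pfree := krylov_free sz vP; set P := krylov v A k in Pfree.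
pose w : 'cV_n.+1 := pinvmx P *m delta_mx (Ordinal (etrans (ltn_predL k) k_gt0)) 0.
pose Q := (krylov w^T A^T k)^T.
have PQu : P *m Q \in unitmx.
  apply: hankel_unit sz va _ => j jk.
  have -> : v *m A ^+ j = row (Ordinal jk) P by rewrite rowK.
  rewrite mulmxA -row_mul mulmxVp // rowE mulmx1 mul_delta_mx_cond mulmxnE.
  rewrite mxE !eqxx -val_eqE /= -[(j.+1 == _)]/(j.+1 == k).
  by have -> : (j == k.-1) = (j.+1 == k) by lia.
pose W := row_base (kermx Q).
have WQ : W *m Q = 0.
  by apply/sub_kermxP; rewrite eq_row_base.
have AQ : A *m Q = Q *m (shiftmx k a)^T.
  apply: trmx_inj; rewrite !trmx_mul !trmxK; apply: krylov_shift sz _.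
  by rewrite hmx_tr -trmx_mul aA mul0mx trmx0.
have WA : (W *m A <= W)%MS.
  by rewrite eq_row_base; apply/sub_kermxP; rewrite -mulmxA AQ mulmxA WQ mul0mx.
exists k, (shiftmx k a), _, (W *m A *m pinvmx W); split=> //.
  exact: cyc_shiftmx.
pose T := col_mx P W.
have Tfree : row_free T.
  apply/inj_row_free => u; rewrite -[u]hsubmxK mul_row_col => uT.
  have u1 : lsubmx u = 0.
    have := congr1 (mulmx^~ Q) uT; rewrite mulmxDl -(mulmxA _ W) WQ mulmx0 addr0 mul0mx -mulmxA.
    move=> /(congr1 (mulmx^~ (invmx (P *m Q)))); by rewrite mul0mx mulmxK.
  move: uT; rewrite u1 mul0mx add0r => /eqP.
  rewrite mulmx_free_eq0 ?row_base_free // => /eqP->.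
  by rewrite row_mx0.
apply: (@free_full_sim _ _ _ _ _ T) => //; last first.
  rewrite mul_col_mx mul_block_col !mul0mx addr0 add0r mulmxKpV //.
  by rewrite (krylov_shift sz va).
(* [Q] has [k] columns, so its kernel has codimension at most [k] and fills the space together with
   the [k] rows of [P]. *)
rewrite -col_leq_rank (eqP Tfree) mxrank_ker.
have rQ : (\rank Q <= k)%N := rank_leq_col Q.
by lia.
Qed.

(** The minimal polynomial is read off from the [p] with [p(A)] of rank 0, so [A] and [B] share it.
    Both split off a cyclic block annihilated by it; subtracting the ranks of this block leaves
    complements with equal ranks, to which induction applies. *)
Theorem rank_sim m n (A : 'M[F]_m) (B : 'M[F]_n) :
  (forall p, \rank (hmx A p) = \rank (hmx B p)) -> sim A B.
Proof.
elim/ltn_ind: m n A B => m IH n A B rAB.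
have mn : m = n by have := rAB 1; rewrite !hmx1 !mxrank1.
case: n / mn B rAB => B rAB; case: m IH A B rAB => [|m] IH A B rAB.
  by rewrite [A]flatmx0 [B]flatmx0; apply: sim_refl.
have minp (A1 B1 : 'M_m.+1) : (forall p, \rank (hmx A1 p) = \rank (hmx B1 p)) ->
    mxminpoly A1 %| mxminpoly B1.
  move=> rk; rewrite dvd_mxminpoly -hmxE -mxrank_eq0 rk hmxE mx_root_minpoly.
  by rewrite mxrank0.
have aE : mxminpoly A = mxminpoly B.
  apply/eqP; rewrite -eqp_monic ?mxminpoly_monic //; apply/andP.
  by split; [exact: minp rAB | apply: minp => p; rewrite rAB].
have [k [C [r [A' [k0 Cc CA]]]]] := cyclic_block A.
have [l [D [s [B' [l0 Dc DB]]]]] := cyclic_block B.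
rewrite -aE in Dc; have CD := cyc_sim Cc Dc.
have rm : (r < m.+1)%N by rewrite -(sim_dim CA) -{1}[r]add0n ltn_add2r.
have AB' : sim A' B'.
  apply: (IH _ rm) => p; have := rAB p.
  rewrite -(sim_rank p CA) -(sim_rank p DB) !hmx_block !rank_diag_block_mx.
  by rewrite (sim_rank p CD) => /addnI.
exact: sim_trans (sim_sym CA) (sim_trans (sim_block CD AB') DB).
Qed.

End Cyclic.

Local Notation deg p := (size p%R).-1.

(** * Elementary divisors *)

Section Blocks.
Variable F : finFieldType.
Implicit Types (p q a b d f : {poly F}) (s t : seq {poly F}).

Lemma degM p q : p != 0 -> q != 0 -> deg (p * q) = (deg p + deg q)%N.
Proof.
move=> p0 q0; rewrite size_mul //.
by move: p0 q0; rewrite -!size_poly_gt0; move: (size p) (size q) => x y; lia.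
Qed.

Lemma deg_eqp p q : p %= q -> deg p = deg q.
Proof. by move/eqp_size->. Qed.

(* The rank of [p(A)] for a direct sum [A] of cyclic blocks annihilated by the
   members of [s]. *)
Definition rank_profile s p : nat := \sum_(a <- s) (deg a - deg (gcdp p a)).

(** By [rank_sim] this means that [A] is similar to the direct sum of cyclic blocks annihilated by
    the members of [s]. In terms of ranks it is visibly independent of the order of [s]. *)
Definition blocks n (A : 'M[F]_n) s :=
  all (fun a => a \is monic) s /\ forall p, \rank (hmx A p) = rank_profile s p.

Lemma blocks_sim m n (A : 'M[F]_m) (B : 'M[F]_n) s :
  blocks A s -> blocks B s -> sim A B.
Proof. by move=> [_ As] [_ Bs]; apply: rank_sim => p; rewrite As Bs. Qed.

Lemma sim_blocks m n (A : 'M[F]_m) (B : 'M[F]_n) s :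
  sim A B -> blocks A s -> blocks B s.
Proof. by move=> AB [mon As]; split=> // p; rewrite -(sim_rank p AB) As. Qed.

Lemma cyc_blocks k (C : 'M[F]_k) a : cyc C a -> blocks C [:: a].
Proof.
move=> [v Ca]; case: (Ca) => mon sz _ _; split; first by rewrite /= mon.
by move=> p; rewrite (cyc_rank Ca) /rank_profile big_seq1 sz.
Qed.

Lemma blocks_cat m n (A : 'M[F]_m) (B : 'M[F]_n) s t :
  blocks A s -> blocks B t -> blocks (block_mx A 0 0 B) (s ++ t).
Proof.
move=> [mA As] [mB Bt]; split=> [|p]; first by rewrite all_cat mA.
by rewrite hmx_block rank_diag_block_mx As Bt /rank_profile big_cat.
Qed.

Lemma blocks_dim n (A : 'M[F]_n) s : blocks A s -> n = (\sum_(a <- s) deg a)%N.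
Proof.
move=> [_ /(_ 1)]; rewrite hmx1 mxrank1 => ->; rewrite /rank_profile; apply: eq_bigr => a _.
by rewrite (deg_eqp (gcd1p a)) size_poly1 subn0.
Qed.

Lemma exists_blocks s : all (fun a => a \is monic) s ->
  exists n (A : 'M[F]_n), blocks A s.
Proof.
elim: s => [_|a s IH /= /andP[mon /IH[n [A As]]]].
  by exists 0%N, 0; split=> // p; rewrite /rank_profile big_nil flatmx0 mxrank0.
have [C Ca] := exists_cyc mon.
by exists _, (block_mx C 0 0 A); rewrite -cat1s; apply: blocks_cat As; apply: cyc_blocks.
Qed.

Lemma blocks_exist n (A : 'M[F]_n) : exists s, blocks A s.
Proof.
elim/ltn_ind: n A => -[|n] IH A.
  by exists [::]; split=> // p; rewrite /rank_profile big_nil flatmx0 mxrank0.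
have [k [C [m [A' [k0 Ca CA]]]]] := cyclic_block A.
have [|s As] := IH m _ A'; first by rewrite -(sim_dim CA) -{1}[m]add0n ltn_add2r.
exists (mxminpoly A :: s); apply: sim_blocks CA _; rewrite -cat1s.
by apply: blocks_cat As; apply: cyc_blocks.
Qed.

(** A direct sum of blocks with these annihilators can be built from scratch; having the same ranks
    as [A], it is similar to [A]. *)
Lemma blocks_cons n (A : 'M[F]_n) a s : blocks A (a :: s) ->
  exists k (C : 'M_k) m (A' : 'M_m),
    [/\ cyc C a, blocks A' s & sim (block_mx C 0 0 A') A].
Proof.
move=> As; case: (As) => /= /andP[mon mons] _.
have [C Ca] := exists_cyc mon; have [m [A' As']] := exists_blocks mons.
exists _, C, m, A'; split=> //; apply: blocks_sim As; rewrite -cat1s.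
by apply: blocks_cat As'; apply: cyc_blocks.
Qed.

Lemma sim_char m n (A : 'M[F]_m) (B : 'M[F]_n) : sim A B -> char_poly A = char_poly B.
Proof.
move=> AB; have mn := sim_dim AB; case: n / mn B AB => B /sim_unit[P Pu PB].
apply: (@mulfI _ (\det (map_mx polyC P))).
  by rewrite det_map_mx polyC_eq0 -unitfE -unitmxE.
rewrite [LHS]mulrC -!det_mulmx; congr (\det _).
by rewrite mulmxBl mulmxBr -!map_mxM PB scalar_mxC.
Qed.

(** By Cayley-Hamilton [a] divides the characteristic polynomial, and both are monic of degree
    [k]. *)
Lemma cyc_char k (C : 'M[F]_k) a : cyc C a -> char_poly C = a.
Proof.
move=> [v Ca]; case: (Ca) => mon sz _ _; apply/esym/eqP.
rewrite -eqp_monic ?char_poly_monic // -dvdp_size_eqp ?size_char_poly ?sz //.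
rewrite -(cyc_dvd Ca); case: k C {v Ca sz} => [|k] C; first by rewrite flatmx0.
by rewrite hmxE Cayley_Hamilton.
Qed.

Lemma block_char m n (A : 'M[F]_m) (B : 'M[F]_n) :
  char_poly (block_mx A 0 0 B) = char_poly A * char_poly B.
Proof. by rewrite /char_poly char_block_diag_mx det_ublock. Qed.

Lemma blocks_char n (A : 'M[F]_n) s : blocks A s -> char_poly A = \prod_(a <- s) a.
Proof.
elim: s n A => [|a s IH] n A As.
  have := blocks_dim As; rewrite !big_nil => n0; rewrite n0 in A As *.
  by rewrite /char_poly det_mx00.
have [k [C [m [A' [Ca As' CA]]]]] := blocks_cons As.
by rewrite big_cons -(sim_char CA) block_char (IH _ _ As') (cyc_char Ca).
Qed.

Lemma gcdp_coprime_mul p a b : coprimep a b -> gcdp p (a * b) %= gcdp p a * gcdp p b.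
Proof.
move=> ab; apply/andP; split; last first.
  rewrite dvdp_gcd; apply/andP; split; last by rewrite dvdp_mul ?dvdp_gcdr.
  rewrite Gauss_dvdp ?dvdp_gcdl //; apply: coprimep_dvdl (dvdp_gcdr _ _) _.
  by rewrite coprimep_sym; apply: coprimep_dvdl (dvdp_gcdr _ _) _; rewrite coprimep_sym.
have [[x y] /= E1] := Bezoutp p a; have [[z t] /= E2] := Bezoutp p b.
rewrite -(eqp_dvdr _ (eqp_trans (eqp_mulr _ E1) (eqp_mull _ E2))) mulrDl; apply: dvdp_add.
  by rewrite -mulrA mulrCA dvdp_mulr ?dvdp_gcdl.
rewrite mulrDr; apply: dvdp_add.
  by rewrite [z * p]mulrC mulrCA dvdp_mulr ?dvdp_gcdl.
by rewrite mulrACA dvdp_mull ?dvdp_gcdr.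
Qed.

(** The Chinese remainder theorem at the level of ranks: the gcd with [a * b] is the product of the
    gcds with [a] and [b]. *)
Lemma rank_profile_coprime_mul p a b : a != 0 -> b != 0 -> coprimep a b ->
  rank_profile [:: a * b] p = rank_profile [:: a; b] p.
Proof.
move=> a0 b0 ab; rewrite /rank_profile !big_cons !big_nil !addn0 degM //.
rewrite (deg_eqp (gcdp_coprime_mul _ ab)) degM ?gcdp_eq0 ?negb_and ?a0 ?b0 ?orbT //.
have le_gcd c : c != 0 -> (deg (gcdp p c) <= deg c)%N.
  move=> c0; have : (size (gcdp p c) <= size c)%N by rewrite dvdp_leq ?dvdp_gcdr.
  by move: (size (gcdp p c)) (size c) => x y; lia.
move: (le_gcd a a0) (le_gcd b b0).
move: (deg (gcdp p a)) (deg (gcdp p b)) (deg a) (deg b) => x y z t; lia.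
Qed.

Lemma rank_profile_cat s t p : rank_profile (s ++ t) p = (rank_profile s p + rank_profile t p)%N.
Proof. by rewrite /rank_profile big_cat. Qed.

Lemma rank_profile_perm s t p : perm_eq s t -> rank_profile s p = rank_profile t p.
Proof. by move=> st; apply: perm_big. Qed.

Definition monic_irred f := irreducibleb f && (f \is monic).

Lemma monic_irredP f : reflect (irreducible_poly f /\ f \is monic) (monic_irred f).
Proof. by apply: (iffP andP) => -[/irreducibleP irr mon]; split=> //; apply/irreducibleP. Qed.

Lemma monic_irred_eqp f g : monic_irred f -> monic_irred g -> f %| g -> f = g.
Proof.
move=> /monic_irredP[[f1 _] fm] /monic_irredP[[_ irr] gm] fg; apply/eqP.
by rewrite -eqp_monic //; apply: irr => //; rewrite gtn_eqF.
Qed.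

Lemma monic_irred_neq0 f : monic_irred f -> f != 0.
Proof. by case/monic_irredP => _ /monic_neq0. Qed.

Lemma monic_irred_deg f : monic_irred f -> (0 < deg f)%N.
Proof. by case/monic_irredP => [[]]; case: size => [|[]]. Qed.

Lemma monic_irred_coprime f g : monic_irred f -> monic_irred g -> coprimep f g = (f != g).
Proof.
move=> fi gi; have [irr _] := monic_irredP _ fi; rewrite irreducible_poly_coprime //.
by congr (~~ _); apply/idP/eqP => [/(monic_irred_eqp fi gi)|->] //; apply: dvdpp.
Qed.

Definition prime_pow (x : {poly F} * nat) := x.1 ^+ x.2.
Definition prim_pair (x : {poly F} * nat) := monic_irred x.1 && (0 < x.2)%N.

Lemma primary_split a : a \is monic ->
  exists2 l, all prim_pair l & forall p, rank_profile [:: a] p = rank_profile (map prime_pow l) p.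
Proof.
move: {2}(size a) (leqnn (size a)) => m; elim: m a => [|m IH] a.
  by rewrite leqn0 size_poly_eq0 => /eqP-> /monic_neq0; rewrite eqxx.
move=> sza mon; have a0 := monic_neq0 mon; case: (leqP (size a) 1) => [a1|a1].
  exists [::] => // p; rewrite /rank_profile big_seq1 big_nil.
  by case: (size a) a1 => [|[]].
have [f [irr fm fa]] := irred_factor a1; have f0 := monic_neq0 fm.
have f1 : (1 < size f)%N by case: irr.
have fi : monic_irred f by apply/monic_irredP.
have [k [c [aE fc]]] := split_power f1 a0.
have k0 : (0 < k)%N by case: k aE fc => // aE; rewrite mul1r in aE; rewrite -aE fa.
have cm : c \is monic by move: mon; rewrite aE monicMl // monic_exp.
have c0 := monic_neq0 cm.
have szc : (size c <= m)%N.
  have := degM (expf_neq0 k f0) c0; rewrite -aE size_exp; move: f1 sza k0.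
  by move: (size f) (size a) (size c) => x y z; case: z y x => [|z] [|y] [|[|x]] //=; nia.
have [l lp lR] := IH c szc cm.
exists ((f, k) :: l) => [|p]; first by rewrite /= /prim_pair /= fi k0.
rewrite aE rank_profile_coprime_mul ?expf_neq0 // ?coprimep_expl ?irreducible_poly_coprime //.
by rewrite -cat1s rank_profile_cat lR -rank_profile_cat.
Qed.

Lemma primary_blocks n (A : 'M[F]_n) :
  exists2 l, all prim_pair l & blocks A (map prime_pow l).
Proof.
have [s [mon sR]] := blocks_exist A.
have [l lp lR] : exists2 l, all prim_pair l &
    forall p, rank_profile s p = rank_profile (map prime_pow l) p.
  elim: s mon {sR} => [_|a s IH /= /andP[am /IH[l lp lR]]]; first by exists [::].
  have [k kp kR] := primary_split am.
  exists (k ++ l) => [|p]; first by rewrite all_cat kp.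
  by rewrite map_cat rank_profile_cat -lR -kR -rank_profile_cat.
exists l => //; split=> [|p]; last by rewrite sR.
by rewrite all_map; apply: sub_all lp => x /andP[/monic_irredP[_ xm] _]; apply: monic_exp.
Qed.

End Blocks.

(** * Unique factorization and multiplicities of elementary divisors *)

Section Factorization.
Variable F : finFieldType.
Implicit Types (p q a b d f g : {poly F}) (s t : seq {poly F}).
Implicit Types (l : seq ({poly F} * nat)).

Lemma monic_irred_dvd_prod f s : monic_irred f -> all (@monic_irred F) s ->
  f %| \prod_(g <- s) g -> f \in s.
Proof.
move=> fi; elim: s => [_|g s IH /= /andP[gi /IH{}IH]].
  by rewrite big_nil (dvdp1 f) => /eqP f1; have := monic_irred_deg fi; rewrite f1.
rewrite big_cons inE; case: eqVneq => [->//|fg].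
by rewrite Gauss_dvdpr ?monic_irred_coprime.
Qed.

Lemma unique_factorization s t : all (@monic_irred F) s -> all (@monic_irred F) t ->
  \prod_(f <- s) f = \prod_(f <- t) f -> perm_eq s t.
Proof.
elim: s t => [|f s IH] t.
  case: t => // g t _ /= /andP[gi _]; move=> E.
  have : g %| \prod_(f <- [::]) f by rewrite E big_cons dvdp_mulr.
  by rewrite big_nil (dvdp1 g) => /eqP g1; have := monic_irred_deg gi; rewrite g1.
move=> /= /andP[fi si] ti E.
have ft : f \in t.
  by apply: monic_irred_dvd_prod fi ti _; move: E; rewrite big_cons => <-; rewrite dvdp_mulr.
have tE := perm_to_rem ft; rewrite perm_sym (perm_trans tE) // perm_cons perm_sym.
apply: IH => //; first by apply/allP => g /mem_rem; apply/allP.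
by move: E; rewrite (perm_big _ tE) !big_cons => /(mulfI (monic_irred_neq0 fi)).
Qed.

Lemma factorization p : p \is monic ->
  exists2 s, all (@monic_irred F) s & \prod_(f <- s) f = p.
Proof.
move: {2}(size p) (leqnn (size p)) => m; elim: m p => [|m IH] p.
  by rewrite leqn0 size_poly_eq0 => /eqP-> /monic_neq0; rewrite eqxx.
move=> szp mon; case: (leqP (size p) 1) => [p1|p1].
  by exists [::] => //; move: mon; rewrite big_nil (size1_polyC p1) monicE lead_coefC => /eqP->.
have [f [irr fm /dvdpP[q pE]]] := irred_factor p1.
have fi : monic_irred f by apply/monic_irredP.
have qm : q \is monic by move: mon; rewrite pE mulrC monicMl.
have [|s si sE] := IH q _ qm.
  have := degM (monic_neq0 qm) (monic_neq0 fm); rewrite -pE; move: (monic_irred_deg fi) szp p1.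
  by move: (size f) (size p) (size q) => x y z; lia.
by exists (f :: s); rewrite /= ?fi // big_cons sE mulrC.
Qed.

(* A list [l] of pairs [(f, i)] stands for the elementary divisors [f ^+ i]. *)
Definition mult_poly l i := \prod_(x <- l | x.2 == i) x.1.

Lemma mult_poly_cons x l i : mult_poly (x :: l) i = (if x.2 == i then x.1 else 1) * mult_poly l i.
Proof. by rewrite /mult_poly big_cons; case: ifP; rewrite ?mul1r. Qed.

Lemma mult_poly_cat l l' i : mult_poly (l ++ l') i = mult_poly l i * mult_poly l' i.
Proof. by rewrite /mult_poly big_cat. Qed.

(** By unique factorization [mult_poly l i] determines the multiset of all [f] with [(f, i)] in
    [l]. *)
Lemma mult_poly_perm l l' : all (@prim_pair F) l -> all (@prim_pair F) l' ->
  (forall i, (0 < i)%N -> mult_poly l i = mult_poly l' i) -> perm_eq l l'.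
Proof.
move=> lp lp' E.
have cnt f i k : count_mem (f, i) k = count_mem f [seq x.1 | x <- k & x.2 == i].
  rewrite count_map count_filter; apply: eq_count => -[g j] /=.
  by rewrite xpair_eqE.
have monic_irred_filter i k : all (@prim_pair F) k ->
    all (@monic_irred F) [seq x.1 | x <- k & x.2 == i].
  move=> kp; rewrite all_map; apply/allP => x; rewrite mem_filter => /andP[_ xk].
  by have /andP[] := allP kp x xk.
have P i : (0 < i)%N ->
    perm_eq [seq x.1 | x <- l & x.2 == i] [seq x.1 | x <- l' & x.2 == i].
  move=> i0; apply: unique_factorization; rewrite ?monic_irred_filter //.
  by have := E i i0; rewrite /mult_poly !big_map !big_filter.
apply/allP => -[f i]; rewrite mem_cat => fi /=.
have i0 : (0 < i)%N by case/orP: fi => [/(allP lp)|/(allP lp')] /andP[].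
by rewrite !cnt; apply/eqP; exact: (seq.permP (P i i0)).
Qed.

Lemma deg_gcd_pow f g i j : monic_irred f -> monic_irred g -> 
  deg (gcdp (f ^+ j) (g ^+ i)) = (if f == g then minn j i * deg g else 0)%N.
Proof.
move=> fi gi; case: eqVneq => [->|fg]; last first.
  have : coprimep (f ^+ j) (g ^+ i) by rewrite coprimep_expl ?coprimep_expr ?monic_irred_coprime.
  by rewrite /coprimep => /eqP->.
by rewrite (deg_eqp (gcdp_exp _ _ _)) size_exp mulnC.
Qed.

(** The second difference of [j |-> min j e] is -1 at [j = e] and 0 elsewhere. The predicate [c]
    selects the irreducibles dividing [p]: a single one when multiplicities are extracted, all of
    them when [p] is the product of the irreducible factors. *)
Lemma rank_profile_second_diff l c p i : (0 < i)%N -> all (@prim_pair F) l ->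
  (forall x j, x \in l -> deg (gcdp (p ^+ j) (prime_pow x)) =
     if c x.1 then (minn j x.2 * deg x.1)%N else 0%N) ->
  (rank_profile (map (@prime_pow F) l) (p ^+ i.-1) +
   rank_profile (map (@prime_pow F) l) (p ^+ i.+1) =
   2 * rank_profile (map (@prime_pow F) l) (p ^+ i) +
   \sum_(x <- l | c x.1 && (x.2 == i)) deg x.1)%N.
Proof.
move=> i0 lp gcdE; rewrite /rank_profile !big_map.
rewrite [X in (_ = _ + X)%N]big_mkcond big_distrr -!big_split /=.
rewrite big_seq [RHS]big_seq; apply: eq_bigr => -[f e] xl.
rewrite !gcdE //= size_exp; case: (c f) => /=; last by rewrite !subn0; lia.
have -> : (if e == i then deg f else 0)%N = ((e == i) * deg f)%N by case: eqP; rewrite ?mul1n.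
rewrite mulnC -!mulnBl mulnA -!mulnDl; congr (_ * _)%N.
by move: i0; case: eqP; lia.
Qed.

End Factorization.

(** * The polynomial invariants of a similarity class *)

Section Invariants.
Variable F : finFieldType.
Implicit Types (p q a b d f g : {poly F}) (s t : seq {poly F}).
Implicit Types (l : seq ({poly F} * nat)).

(* The number of elementary divisors of [A] equal to [f ^+ i], as a second
   difference of ranks. *)
Definition multiplicity_of n (A : 'M[F]_n) f i :=
  ((\rank (hmx A (f ^+ i.-1)) + \rank (hmx A (f ^+ i.+1))
    - 2 * \rank (hmx A (f ^+ i))) %/ deg f)%N.

(* The polynomial u_i; [{poly_n.+1 F}] contains every irreducible factor. *)
Definition type_poly n (A : 'M[F]_n) i :=
  \prod_(f : {poly_n.+1 F} | monic_irred f) (f : {poly F}) ^+ multiplicity_of A f i.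

Definition primary n (A : 'M[F]_n) l := all (@prim_pair F) l /\ blocks A (map (@prime_pow F) l).

Lemma primary_exist n (A : 'M[F]_n) : exists l, primary A l.
Proof. by have [l lp lb] := primary_blocks A; exists l. Qed.

Lemma multiplicity_ofE n (A : 'M[F]_n) l f i : primary A l -> monic_irred f -> (0 < i)%N ->
  multiplicity_of A f i = count_mem (f, i) l.
Proof.
move=> [lp [_ Al]] fi i0; rewrite /multiplicity_of !Al.
rewrite (@rank_profile_second_diff _ _ (pred1 f)) //; last first.
  move=> [g j] k /(allP lp) /andP[gi _]; rewrite deg_gcd_pow //=.
  by rewrite eq_sym.
rewrite addKn (eq_bigl (pred1 (f, i))); last by move=> [g j]; rewrite /= xpair_eqE.
rewrite (eq_bigr (fun=> deg f)); last by move=> x /eqP->.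
by rewrite big_const_seq iter_addn_0 mulnC mulnK ?monic_irred_deg.
Qed.

Lemma primary_dim n (A : 'M[F]_n) l : primary A l ->
  n = (\sum_(x <- l) x.2 * deg x.1)%N.
Proof.
move=> [_ /blocks_dim->]; rewrite big_map; apply: eq_bigr => x _.
by rewrite size_exp mulnC.
Qed.

Lemma primary_bound n (A : 'M[F]_n) l x : primary A l -> x \in l ->
  (0 < x.2 <= n)%N /\ (size x.1 <= n.+1)%N.
Proof.
move=> Al xl; have /andP[xi x0] : prim_pair x by apply: (allP Al.1).
have xn : (x.2 * deg x.1 <= n)%N by rewrite (primary_dim Al) (big_rem _ xl) leq_addr.
have dx := monic_irred_deg xi; split; first by rewrite x0 (leq_trans _ xn) // leq_pmulr.
have : (deg x.1 <= n)%N by rewrite (leq_trans _ xn) // leq_pmull.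
by move: (size x.1) => [|y].
Qed.

Lemma type_polyE n (A : 'M[F]_n) l i : primary A l -> (0 < i)%N -> type_poly A i = mult_poly l i.
Proof.
move=> Al i0; rewrite /mult_poly big_seq_cond.
rewrite (partition_big (fun x => npolyp n.+1 x.1)
  (fun f : {poly_n.+1 F} => monic_irred (f : {poly F}))) /=; last first.
  move=> x /andP[xl _]; have [_ xn] := primary_bound Al xl.
  by rewrite npolypK //; case/andP: (allP Al.1 x xl).
apply: eq_bigr => f fi; rewrite (multiplicity_ofE Al fi i0).
rewrite (eq_big (fun x => (x \in l) && (x == (f : {poly F}, i))) (fun=> f : {poly F})).
- by rewrite -big_seq_cond big_const_seq iter_mulr_1.
- move=> [g j] /=; rewrite xpair_eqE; case: (boolP ((g, j) \in l)) => //= gl.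
  rewrite andbC; congr (_ && _); have [_ gn] := primary_bound Al gl.
  by rewrite -val_eqE /= npolypK.
by move=> [g j] /andP[/andP[/(primary_bound Al) [_ /= gn] _] /eqP <-]; rewrite /= npolypK.
Qed.

End Invariants.

(** * Inverse matrices and reciprocal polynomials *)

Section Reciprocal.
Variable F : fieldType.
Implicit Types (p q a b d f g : {poly F}).

(** The reversal [X^e p(1/X)] for [p] of degree at most [e]. Keeping [e] separate from the degree
    makes the operation linear. *)
Definition revp e p : {poly F} := \poly_(i < e.+1) p`_(e - i).

Lemma coef_revp e p i : (revp e p)`_i = if (i <= e)%N then p`_(e - i) else 0.
Proof. by rewrite coef_poly ltnS. Qed.

Lemma revpD e p q : revp e (p + q) = revp e p + revp e q.
Proof. by apply/polyP => i; rewrite coefD !coef_revp coefD; case: ifP; rewrite ?addr0. Qed.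

Lemma revpZ e c p : revp e (c *: p) = c *: revp e p.
Proof. by apply/polyP => i; rewrite coefZ !coef_revp coefZ; case: ifP; rewrite ?mulr0. Qed.

Lemma revp0 e : revp e 0 = 0.
Proof. by rewrite -[X in revp e X](scale0r (0 : {poly F})) revpZ scale0r. Qed.

Lemma revp_sum e I (r : seq I) (P : pred I) (E : I -> {poly F}) :
  revp e (\sum_(i <- r | P i) E i) = \sum_(i <- r | P i) revp e (E i).
Proof. exact: (big_morph _ (revpD e) (revp0 e)). Qed.

Lemma revpXn e i : (i <= e)%N -> revp e 'X^i = 'X^(e - i).
Proof.
move=> ie; apply/polyP => k; rewrite coef_revp !coefXn; case: leqP => ke.
  by have -> : (e - k == i)%N = (k == e - i)%N by lia.
by have -> : (k == e - i)%N = false by lia.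
Qed.

Lemma poly_sumX e p : (size p <= e.+1)%N -> p = \sum_(i < e.+1) p`_i *: 'X^i.
Proof.
move=> pe; rewrite -[LHS](poly_rV_K pe) /rVpoly poly_def; apply: eq_bigr => i _.
by rewrite valK mxE.
Qed.

Lemma revpM e e' p q : (size p <= e.+1)%N -> (size q <= e'.+1)%N ->
  revp (e + e') (p * q) = revp e p * revp e' q.
Proof.
move=> /poly_sumX-> /poly_sumX->.
rewrite mulr_suml !revp_sum mulr_suml; apply: eq_bigr => i _.
rewrite mulr_sumr !revp_sum mulr_sumr; apply: eq_bigr => j _.
have ie : (i <= e)%N by rewrite -ltnS.
have je : (j <= e')%N by rewrite -ltnS.
rewrite -scalerAl -scalerAr !revpZ -scalerAl -scalerAr -exprD !revpXn ?leq_add //.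
by rewrite -exprD; congr (_ *: (_ *: 'X^_)); lia.
Qed.

Lemma revpK e p : (size p <= e.+1)%N -> revp e (revp e p) = p.
Proof.
move=> pe; apply/polyP => i; rewrite !coef_revp; case: leqP => ie.
  by rewrite leq_subr subKn.
by rewrite nth_default // (leq_trans pe).
Qed.

Lemma size_revp e p : p`_0 != 0 -> size (revp e p) = e.+1.
Proof.
move=> p0; apply/eqP; rewrite eqn_leq size_poly /=; rewrite ltnNge; apply/negP => se.
by have := coef_revp e p e; rewrite leqnn subnn nth_default // => /esym/eqP; apply/negP.
Qed.

(* Meaningful only when [p`_0 != 0]. *)
Definition recip p := (p`_0)^-1 *: revp (size p).-1 p.

Lemma size_recip p : p`_0 != 0 -> size (recip p) = size p.
Proof.
move=> p0; rewrite size_scale ?invr_eq0 // size_revp // prednK // lt0n size_poly_eq0.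
by apply: contraNneq p0 => ->; rewrite coef0.
Qed.

Lemma recip_coef0 p : p`_0 != 0 -> (recip p)`_0 = (p`_0)^-1 * lead_coef p.
Proof. by move=> p0; rewrite coefZ coef_revp leq0n subn0. Qed.

Lemma recip_monic p : p`_0 != 0 -> recip p \is monic.
Proof.
move=> p0; rewrite monicE /lead_coef size_recip // coefZ coef_revp leqnn subnn.
by rewrite mulVf.
Qed.

Lemma coef0_neq0 p : p`_0 != 0 -> p != 0.
Proof. by apply: contraNneq => ->; rewrite coef0. Qed.

Lemma coef0M p q : (p * q)`_0 = p`_0 * q`_0.
Proof. by rewrite -!horner_coef0 hornerM. Qed.

Lemma recipM p q : p`_0 != 0 -> q`_0 != 0 -> recip (p * q) = recip p * recip q.
Proof.
move=> p0 q0; rewrite /recip coef0M -scalerAl -scalerAr scalerA -invfM -revpM.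
- congr (_ *: revp _ _); rewrite size_mul ?coef0_neq0 //.
  have := coef0_neq0 p0; have := coef0_neq0 q0; rewrite -!size_poly_gt0.
  by move: (size p) (size q) => x y; lia.
- by rewrite leqSpred.
- by rewrite leqSpred.
Qed.

Lemma recip_recip p : p`_0 != 0 -> recip (recip p) = (lead_coef p)^-1 *: p.
Proof.
move=> p0; rewrite {1}/recip size_recip // recip_coef0 // invfM invrK.
by rewrite /recip revpZ revpK ?leqSpred // scalerA mulrAC mulfV ?mul1r.
Qed.

Lemma recip1 : recip 1 = 1.
Proof.
apply/eqP; have m : recip 1 \is monic by rewrite recip_monic // coef1 oner_eq0.
have := size_recip; move/(_ 1); rewrite coef1 oner_eq0 size_poly1 => /(_ isT) sz.
by move: m; rewrite (size1_polyC (eq_leq sz)) monicE lead_coefC => /eqP->.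
Qed.

(** Reversing a factor of [recip p] gives a factor of [p] of the same size; the constant term of the
    factor is nonzero because that of [recip p] is. *)
Lemma recip_irr p : p`_0 != 0 -> irreducible_poly p -> irreducible_poly (recip p).
Proof.
move=> p0 [p1 irr]; have p1' : recip p != 0 by rewrite monic_neq0 ?recip_monic.
split=> [|q q1 /dvdpP[r rE]]; first by rewrite size_recip.
have: (recip p)`_0 != 0.
  by rewrite recip_coef0 // mulf_neq0 ?invr_eq0 // lead_coef_eq0 coef0_neq0.
rewrite rE coef0M mulf_eq0 negb_or => /andP[r0 q0].
rewrite -dvdp_size_eqp ?rE ?dvdp_mull // -rE size_recip // -(size_recip q0).
apply/eqP/eqp_size/irr; first by rewrite size_recip.
apply/dvdpP; exists (lead_coef p *: recip r); rewrite -scalerAl -recipM // -rE.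
by rewrite recip_recip // scalerA mulfV ?scale1r // lead_coef_eq0 coef0_neq0.
Qed.

Lemma hmx_inv n (A : 'M[F]_n) e p : A \in unitmx -> (size p <= e.+1)%N ->
  hmx A 'X^e *m hmx (invmx A) p = hmx A (revp e p).
Proof.
move=> Au pe; rewrite {1}(poly_sumX pe) {2}(poly_sumX pe) revp_sum !hmx_sum mulmx_sumr.
apply: eq_bigr => i _; have ie : (i <= e)%N by rewrite -ltnS.
rewrite revpZ !hmxZ -scalemxAr revpXn //; congr (_ *: _).
rewrite -{1}(subnK ie) exprD hmxM -mulmxA.
suff -> : hmx A 'X^i *m hmx (invmx A) 'X^i = 1%:M by rewrite mulmx1.
elim: {ie} (nat_of_ord i) => [|k IH]; first by rewrite !hmx1 mulmx1.
rewrite {1}exprSr exprS !hmxM mulmxA -(mulmxA _ (hmx A 'X)) !hmxX mulmxV // mulmx1.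
exact: IH.
Qed.

Lemma hmx_Xn_unit n (A : 'M[F]_n) e : A \in unitmx -> hmx A 'X^e \in unitmx.
Proof.
move=> Au; elim: e => [|e IH]; first by rewrite hmx1 unitmx1.
by rewrite exprS hmxM unitmx_mul hmxX Au.
Qed.

Lemma cyc_inv k (A : 'M[F]_k) a v : A \in unitmx -> a`_0 != 0 ->
  cyc_vec A a v -> cyc_vec (invmx A) (recip a) v.
Proof.
move=> Au a0 Aa; case: (Aa) => mon sz va Ku; split.
- exact: recip_monic.
- by rewrite size_recip.
- suff -> : hmx (invmx A) (recip a) = 0 by rewrite mulmx0.
  apply: (can_inj (mulKmx (hmx_Xn_unit k Au))); rewrite mulmx0 hmx_inv ?size_recip ?sz //.
  rewrite /recip sz revpZ revpK ?sz // hmxZ (_ : hmx A a = 0) ?scaler0 //.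
  by apply/eqP; rewrite (cyc_dvd Aa) dvdpp.
rewrite -row_free_unit; apply/inj_row_free => u; rewrite mul_krylov.
(* Multiplication by [A^(k-1)] turns a relation between the [v A^(-i)], [i < k], into one between
   the [v A^i], [i < k], which is trivial. *)
move=> /(congr1 (mulmx^~ (hmx A 'X^(k.-1)))); rewrite mul0mx -mulmxA.
case: k A a v Au a0 Aa mon sz va Ku u => [|k] A a v Au a0 Aa mon sz va Ku u.
  by rewrite [u]thinmx0.
rewrite -(hmx_inter (A := invmx A) (B := invmx A)) ?hmx_inv ?size_poly //; last first.
  by apply/esym/hmx_inter; rewrite mulmxV // mulVmx.
move/eqP; rewrite (cyc_vec_dvd Aa) => adv; apply: (can_inj rVpolyK); rewrite raddf0.
rewrite -[rVpoly u](@revpK k) ?size_poly //.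
have -> : revp k (rVpoly u) = 0; last by rewrite revp0.
apply/eqP; apply: contraTT adv => r0; apply/negP => /dvdp_leq => /(_ r0).
by rewrite sz ltnNge size_poly.
Qed.

End Reciprocal.

(** * Classification by the type polynomials, and their behaviour under inversion *)

Section TypePolynomials.
Variable F : finFieldType.
Implicit Types (p q a b d f g : {poly F}) (s t : seq {poly F}).
Implicit Types (l : seq ({poly F} * nat)).

Lemma char_coef0 n (A : 'M[F]_n) : (char_poly A)`_0 != 0 = (A \in unitmx).
Proof. by rewrite char_poly_det mulf_eq0 signr_eq0 /= unitmxE unitfE. Qed.

Lemma block_unit m n (A : 'M[F]_m) (B : 'M[F]_n) :
  (block_mx A 0 0 B \in unitmx) = (A \in unitmx) && (B \in unitmx).
Proof. by rewrite !unitmxE det_ublock unitrM. Qed.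

Lemma sim_in_unit m n (A : 'M[F]_m) (B : 'M[F]_n) :
  sim A B -> (A \in unitmx) = (B \in unitmx).
Proof. by move=> AB; rewrite -!char_coef0 (sim_char AB). Qed.

Lemma sim_invmx m n (A : 'M[F]_m) (B : 'M[F]_n) :
  sim A B -> A \in unitmx -> sim (invmx A) (invmx B).
Proof.
move=> AB Au; have Bu : B \in unitmx by rewrite -(sim_in_unit AB).
case: AB => [T [S [TS ST TB]]]; exists T, S; split=> //.
by rewrite -[RHS](mulmxK Bu) -[invmx A *m T *m B]mulmxA TB mulKmx.
Qed.

Lemma block_inv m n (A : 'M[F]_m) (B : 'M[F]_n) : A \in unitmx -> B \in unitmx ->
  invmx (block_mx A 0 0 B) = block_mx (invmx A) 0 0 (invmx B).
Proof.
move=> Au Bu; have ABu : block_mx A 0 0 B \in unitmx by rewrite block_unit Au.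
apply: (can_inj (mulKmx ABu)); rewrite mulmxV // mulmx_block.
by rewrite !(mulmx0, mul0mx, addr0, add0r) !mulmxV // -scalar_mx_block.
Qed.

Lemma blocks_inv n (A : 'M[F]_n) s : A \in unitmx -> blocks A s ->
  blocks (invmx A) (map (@recip F) s).
Proof.
elim: s n A => [|a s IH] n A Au As.
  have := blocks_dim As; rewrite big_nil => n0; rewrite n0 in A Au As *.
  by split=> // p; rewrite /rank_profile big_nil flatmx0 mxrank0.
have [k [C [m [A' [[v Ca] As' CA]]]]] := blocks_cons As.
have := Au; rewrite -(sim_in_unit CA) block_unit => /andP[Cu A'u].
have a0 : a`_0 != 0 by rewrite -(cyc_char (ex_intro _ v Ca)) char_coef0.
have CAu : block_mx C 0 0 A' \in unitmx by rewrite block_unit Cu.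
apply: sim_blocks (sim_invmx CA CAu) _; rewrite block_inv //= -cat1s.
by apply: blocks_cat (IH _ _ A'u As'); apply: cyc_blocks; exists v; apply: cyc_inv.
Qed.

Definition recip_pair (x : {poly F} * nat) := (recip x.1, x.2).

Lemma primary_char n (A : 'M[F]_n) l : primary A l -> char_poly A = \prod_(x <- l) prime_pow x.
Proof. by move=> [_ /blocks_char->]; rewrite big_map. Qed.

Lemma primary_coef0 n (A : 'M[F]_n) l x : A \in unitmx -> primary A l ->
  x \in l -> x.1`_0 != 0.
Proof.
move=> Au Al xl; move: Au; rewrite -char_coef0 (primary_char Al) (big_rem _ xl) /=.
rewrite coef0M mulf_eq0 negb_or -!horner_coef0 horner_exp => /andP[].
have /andP[_ x0] : prim_pair x := allP Al.1 x xl.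
by rewrite expf_eq0 x0.
Qed.

Lemma recipX p k : p`_0 != 0 -> recip (p ^+ k) = recip p ^+ k.
Proof.
move=> p0; elim: k => [|k IH]; first by rewrite recip1.
rewrite !exprS recipM // ?IH //.
by rewrite -horner_coef0 horner_exp horner_coef0 expf_neq0.
Qed.

Lemma monic_irred_recip f : f`_0 != 0 -> monic_irred f -> monic_irred (recip f).
Proof.
move=> f0 /monic_irredP[irr _].
by apply/monic_irredP; split; [apply: recip_irr|apply: recip_monic].
Qed.

Lemma primary_inv n (A : 'M[F]_n) l : A \in unitmx -> primary A l ->
  primary (invmx A) (map recip_pair l).
Proof.
move=> Au Al; have l0 := primary_coef0 Au Al; case: (Al) => lp Ab; split.
  rewrite all_map; apply/allP => x xl; have /andP[fi x0] := allP lp x xl.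
  by rewrite /= /prim_pair /= x0 monic_irred_recip ?l0.
have := blocks_inv Au Ab; rewrite -!map_comp.
by congr blocks; apply/eq_in_map => x xl /=; rewrite /prime_pow /= recipX ?l0.
Qed.

Lemma mult_poly_recip_pair l i : (forall x, x \in l -> x.1`_0 != 0) ->
  mult_poly (map recip_pair l) i = recip (mult_poly l i) /\ (mult_poly l i)`_0 != 0.
Proof.
elim: l => [_|x l IH l0]; first by rewrite /mult_poly !big_nil recip1 coef1 oner_eq0.
have [|E u0] := IH; first by move=> y yl; rewrite l0 // inE yl orbT.
have x0 : x.1`_0 != 0 by rewrite l0 ?inE ?eqxx.
rewrite /= !mult_poly_cons E coef0M mulf_eq0 negb_or u0 andbT; case: (_ == i) => //=.
  by rewrite recipM.
by rewrite !mul1r coef1 oner_eq0.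
Qed.

Lemma type_poly_inv n (A : 'M[F]_n) i : A \in unitmx -> (0 < i)%N ->
  type_poly (invmx A) i = recip (type_poly A i).
Proof.
move=> Au i0; have [l Al] := primary_exist A.
rewrite (type_polyE (primary_inv Au Al) i0) (type_polyE Al i0).
by have [|->] := @mult_poly_recip_pair l i => // x; apply: primary_coef0 Au Al.
Qed.

Lemma type_poly_coef0 n (A : 'M[F]_n) i : A \in unitmx -> (0 < i)%N -> (type_poly A i)`_0 != 0.
Proof.
move=> Au i0; have [l Al] := primary_exist A; rewrite (type_polyE Al i0).
by have [|_] := @mult_poly_recip_pair l i => // x; apply: primary_coef0 Au Al.
Qed.

Lemma mult_poly_monic l i : all (@prim_pair F) l -> mult_poly l i \is monic.
Proof.
move=> lp; rewrite /mult_poly big_seq_cond; apply: monic_prod => x /andP[xl _].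
by have /andP[/monic_irredP[]] := allP lp x xl.
Qed.

Lemma type_poly_monic n (A : 'M[F]_n) i : (0 < i)%N -> type_poly A i \is monic.
Proof.
move=> i0; have [l Al] := primary_exist A; rewrite (type_polyE Al i0).
by apply: mult_poly_monic; case: Al.
Qed.

Lemma prod_mult_poly n l : (forall x, x \in l -> 0 < x.2 <= n)%N ->
  \prod_(x <- l) prime_pow x = \prod_(i < n) mult_poly l i.+1 ^+ i.+1.
Proof.
elim: l => [_|x l IH ln].
  by rewrite big_nil big1 // => i _; rewrite /mult_poly big_nil expr1n.
rewrite big_cons IH; last by move=> y yl; rewrite ln // inE yl orbT.
rewrite [RHS](eq_bigr (fun i : 'I_n => (if x.2 == i.+1 then x.1 ^+ i.+1 else 1) *
   mult_poly l i.+1 ^+ i.+1)); last first.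
  by move=> i _; rewrite mult_poly_cons exprMn; case: ifP => //; rewrite expr1n.
rewrite big_split -big_mkcond /=; congr (_ * _).
have /andP[x0 xn] : (0 < x.2 <= n)%N by rewrite ln ?inE ?eqxx.
have x1n : (x.2.-1 < n)%N by rewrite prednK.
rewrite (big_pred1 (Ordinal x1n)) /= ?prednK // => i /=.
by rewrite -val_eqE /= -[X in X == i.+1](prednK x0) eqSS eq_sym.
Qed.

Lemma type_poly_char n (A : 'M[F]_n) : char_poly A = \prod_(i < n) type_poly A i.+1 ^+ i.+1.
Proof.
have [l Al] := primary_exist A; rewrite (primary_char Al) (@prod_mult_poly n).
  by apply: eq_bigr => i _; rewrite (type_polyE Al).
by move=> x xl; case: (primary_bound Al xl).
Qed.

Lemma deg_prod n (E : 'I_n -> {poly F}) : (forall i, E i \is monic) ->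
  deg (\prod_(i < n) E i) = (\sum_(i < n) deg (E i))%N.
Proof.
elim: n E => [|n IH] E Em; first by rewrite !big_ord0 size_poly1.
rewrite !big_ord_recl degM ?monic_neq0 // ?IH //; apply: monic_prod => *; exact: Em.
Qed.

Lemma type_poly_dim n (A : 'M[F]_n) : (\sum_(i < n) i.+1 * deg (type_poly A i.+1))%N = n.
Proof.
have := size_char_poly A; rewrite type_poly_char => /(congr1 predn) /= dimE.
rewrite -[RHS]dimE deg_prod; last by move=> i; rewrite monic_exp // type_poly_monic.
by apply: eq_bigr => i _; rewrite size_exp mulnC.
Qed.

Lemma type_poly_size n (A : 'M[F]_n) (i : 'I_n) : (size (type_poly A i.+1) <= n.+1)%N.
Proof.
have : (i.+1 * deg (type_poly A i.+1) <= n)%N.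
  by rewrite (leq_trans _ (eq_leq (type_poly_dim A))) // (bigD1 i) //= leq_addr.
move: (size (type_poly A i.+1)) => [|y] //=; rewrite ltnS; apply: leq_trans.
by rewrite leq_pmull.
Qed.

Lemma type_poly_sim n (A B : 'M[F]_n) :
  (forall i : 'I_n, type_poly A i.+1 = type_poly B i.+1) <-> sim A B.
Proof.
have [l Al] := primary_exist A; have [k Bk] := primary_exist B.
split=> [E|AB i].
  have lk : perm_eq l k.
    apply: mult_poly_perm; [by case: Al | by case: Bk | case=> // i _].
    case: (ltnP i n) => ni.
      by rewrite -(type_polyE Al) // -(type_polyE Bk) // (E (Ordinal ni)).
    (* No elementary divisor has an exponent greater than [n], so the polynomials of larger index
       are 1. *)
    have out h C : @primary F n C h -> mult_poly h i.+1 = 1.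
      move=> Ch; rewrite /mult_poly big_seq_cond big_pred0 // => x; apply/negP.
      move=> /andP[/(primary_bound Ch)[/andP[_ xn] _] /eqP xi].
      by move: xn; rewrite xi ltnNge ni.
    by rewrite (out l A) // (out k B).
  apply: rank_sim => p; rewrite Al.2.2 Bk.2.2.
  by apply: rank_profile_perm; apply: perm_map.
rewrite (type_polyE Al) // (@type_polyE _ _ B l) //.
by case: Al => lp Ab; split=> //; apply: sim_blocks Ab.
Qed.

Lemma exists_mult_poly (u : nat -> {poly F}) m : (forall i, u i \is monic) ->
  exists2 l, all (@prim_pair F) l & forall i, mult_poly l i = if (0 < i <= m)%N then u i else 1.
Proof.
move=> um; elim: m => [|m [l lp lE]].
  by exists [::] => // i; rewrite /mult_poly big_nil; case: i.
have [s si sE] := factorization (um m.+1).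
exists ([seq (f, m.+1) | f <- s] ++ l).
  rewrite all_cat lp andbT all_map; apply: sub_all si => f fi.
  by rewrite /= /prim_pair /= fi.
move=> i; rewrite mult_poly_cat lE {1}/mult_poly big_map /=.
case: (eqVneq m.+1 i) => [<-|mi].
  by rewrite sE ltnn /= mulr1 leqnn.
rewrite big_pred0_eq mul1r; congr (if _ then _ else _).
by move: mi; case: i => //= i; rewrite eqSS !ltnS => mi; rewrite [RHS]leq_eqVlt eq_sym (negPf mi).
Qed.

(** The irreducible factors of the [u i] prescribe the elementary divisors; the resulting matrix has
    size [n], the degree of its characteristic polynomial. *)
Lemma exists_type_poly n (u : nat -> {poly F}) : (forall i, u i \is monic) ->
  (\sum_(i < n) i.+1 * deg (u i.+1))%N = n ->
  exists A : 'M[F]_n, forall i : 'I_n, type_poly A i.+1 = u i.+1.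
Proof.
move=> um un; have [l lp lE] := exists_mult_poly n um.
have [m [A As]] : exists m (A : 'M_m), blocks A (map (@prime_pow F) l).
  apply: exists_blocks; rewrite all_map; apply: sub_all lp => x /andP[/monic_irredP[_ xm] _].
  exact: monic_exp.
have Al : primary A l by split.
have ln x : x \in l -> (0 < x.2 <= n)%N.
  move=> xl; have /andP[/monic_irredP[[x1 _] xm] x0] := allP lp x xl; rewrite x0 /= leqNgt.
  apply/negP => nx; have := lE x.2; rewrite x0 /= leqNgt nx /= => mult_poly1.
  have : x.1 %| mult_poly l x.2 by rewrite /mult_poly (big_rem _ xl) /= eqxx dvdp_mulr.
  by rewrite mult_poly1 (dvdp1 x.1) => /eqP x11; rewrite x11 in x1.
have mn : m = n.
  have := size_char_poly A; rewrite (primary_char Al) (prod_mult_poly ln) => /(congr1 predn) /= <-.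
  rewrite deg_prod; last by move=> i; rewrite monic_exp // mult_poly_monic.
  rewrite -[RHS]un; apply: eq_bigr => i _; by rewrite size_exp mulnC lE ltn_ord.
move: A As Al; rewrite mn => A As Al; exists A => i.
by rewrite (type_polyE Al) // lE ltn_ord.
Qed.

End TypePolynomials.

(** * Determinants of commuting matrices *)

Section RestrictedDet.
Variable F : fieldType.

(* The determinant of [c] on the row space of [V], which has to be stable under
   [c] ([pinvmx] gives an irrelevant value otherwise). *)
Definition rdet n (V c : 'M[F]_n) :=
  \det (row_base V *m c *m pinvmx (row_base V)).

(** The matrices of a restriction in two bases are conjugate under the change of basis [P]. *)
Lemma rdetE n (V c : 'M[F]_n) m (B : 'M_(m, n)) M :
  row_free B -> (B :=: V)%MS -> B *m c = M *m B -> rdet V c = \det M.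
Proof.
move=> Bf BV BM; have mV : m = \rank V by rewrite -BV; apply/esym/eqP.
case: _ / (esym mV) B M Bf BV BM => B M Bf BV BM.
have VB : (row_base V <= B)%MS by rewrite eq_row_base BV.
have Vc : (row_base V *m c <= row_base V)%MS.
  by rewrite (eqmxMr c (eq_row_base V)) eq_row_base -(eqmxMr c BV) BM -BV submxMl.
rewrite /rdet; set M' := _ *m pinvmx _.
have M'E : M' *m row_base V = row_base V *m c by rewrite mulmxKpV.
set P := row_base V *m pinvmx B.
have PB : P *m B = row_base V by rewrite mulmxKpV.
have Pu : P \in unitmx.
  rewrite -row_free_unit; apply: inj_row_free => u uP.
  have /eqP : u *m row_base V = 0 by rewrite -PB mulmxA uP mul0mx.
  by rewrite mulmx_free_eq0 ?row_base_free // => /eqP.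
have MP : M' *m P = P *m M.
  apply: (row_free_inj Bf); rewrite /= -(mulmxA M') PB M'E -(mulmxA P) -BM.
  by rewrite mulmxA PB.
have := congr1 determinant MP; rewrite !det_mulmx mulrC.
by apply: mulfI; rewrite -unitfE -unitmxE.
Qed.

Lemma rdet_eqmx n (V V' c : 'M[F]_n) : (V' *m c <= V')%MS -> (V :=: V')%MS ->
  rdet V c = rdet V' c.
Proof.
move=> V'c VV'; apply: (rdetE (row_base_free V')).
  by apply: eqmx_trans (eq_row_base V') (eqmx_sym VV').
by rewrite mulmxKpV // (eqmxMr c (eq_row_base V')) eq_row_base.
Qed.

Lemma rdet1 n (c : 'M[F]_n) : rdet 1%:M c = \det c.
Proof.
by apply: (@rdetE _ _ _ _ 1%:M); rewrite ?mul1mx ?mulmx1 // -row_leq_rank mxrank1.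
Qed.

Lemma rdet0 n (c : 'M[F]_n) : rdet 0 c = 1.
Proof.
rewrite -[RHS](det1 F 0); apply: (@rdetE _ _ _ _ (0 : 'M_(0, n))).
- by rewrite -row_leq_rank.
- by apply/eqmxP; rewrite !sub0mx.
- by rewrite [LHS]flatmx0 [RHS]flatmx0.
Qed.

(* [V / (V :&: kermx N)] is isomorphic to [V *m N] by multiplication by [N], which
   commutes with [c]. *)
Lemma rdet_split n (V c N : 'M[F]_n) : c *m N = N *m c -> (V *m c <= V)%MS ->
  rdet V c = rdet (V :&: kermx N)%MS c * rdet (V *m N) c.
Proof.
move=> cN Vc; set K := (V :&: kermx N)%MS.
have Kc : (K *m c <= K)%MS.
  rewrite sub_capmx (submx_trans (submxMr c (capmxSl _ _)) Vc) /=.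
  apply/sub_kermxP; rewrite -mulmxA cN mulmxA.
  by have /sub_kermxP-> := capmxSr V (kermx N); rewrite mul0mx.
pose D := row_base (V :\: kermx N)%MS; pose B := row_base K.
have Df : row_free D := row_base_free _; have Bf : row_free B := row_base_free _.
have DV : (D <= V)%MS by rewrite eq_row_base diffmxSl.
have BN : B *m N = 0 by apply/sub_kermxP; rewrite eq_row_base capmxSr.
have DK0 u : u *m D *m N = 0 -> u = 0.
  move=> uDN; have : (u *m D <= (V :\: kermx N) :&: kermx N)%MS.
    rewrite sub_capmx; apply/andP; split; last exact/sub_kermxP.
    by rewrite (submx_trans (submxMl _ _)) // eq_row_base.
  by rewrite capmx_diff submx0 mulmx_free_eq0 // => /eqP.
have DBV : (col_mx D B :=: V)%MS.
  apply: eqmx_trans (eqmx_sym (addsmxE _ _)) _.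
  apply: eqmx_trans (adds_eqmx (eq_row_base _) (eq_row_base _)) _.
  exact: addsmx_diff_cap_eq.
have DBf : row_free (col_mx D B).
  apply/inj_row_free => u; rewrite -[u]hsubmxK mul_row_col => uDB.
  have u1 : lsubmx u = 0.
    apply: DK0; have := congr1 (mulmx^~ N) uDB.
    by rewrite mulmxDl -(mulmxA _ B) BN mulmx0 addr0 mul0mx.
  move: uDB; rewrite u1 mul0mx add0r => /eqP; rewrite mulmx_free_eq0 // => /eqP->.
  by rewrite row_mx0.
have Dc : (D *m c <= col_mx D B)%MS.
  by rewrite DBV (submx_trans (submxMr c DV)).
set X := D *m c *m pinvmx (col_mx D B).
have XE : D *m c = lsubmx X *m D + rsubmx X *m B.
  by rewrite -mul_row_col hsubmxK mulmxKpV.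
set k := B *m c *m pinvmx B.
have kE : B *m c = k *m B by rewrite mulmxKpV // (eqmxMr c (eq_row_base K)) eq_row_base.
rewrite (@rdetE _ V c _ _ (block_mx (lsubmx X) (rsubmx X) 0 k) DBf DBV); last first.
  by rewrite mul_col_mx mul_block_col mul0mx add0r XE kE.
rewrite det_ublock mulrC -/k; congr (_ * _); apply/esym.
have VNE : (D *m N :=: V *m N)%MS.
  apply: eqmx_trans (eqmxMr N DBV); rewrite mul_col_mx BN.
  apply: eqmx_trans (addsmxE _ _); apply/eqmx_sym; exact: addsmx0.
apply: rdetE VNE _; first by apply/inj_row_free => u; rewrite mulmxA; apply: DK0.
by rewrite -mulmxA -cN mulmxA XE mulmxDl -(mulmxA _ B) BN mulmx0 addr0 mulmxA.
Qed.

(** For nilpotent [N] the rank of this space is the number of Jordan blocks of size greater than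
    [j]. *)
Definition layer n (N : 'M[F]_n) j := (N ^+ j :&: kermx N)%MS.

(** Applied to the image of [N^k], [rdet_split] separates the layer [k] and leaves the image of
    [N^(k+1)]; the process ends at [N^e = 0]. *)
Lemma det_layers n (c N : 'M[F]_n) e : c *m N = N *m c -> N ^+ e = 0 ->
  \det c = \prod_(j < e) rdet (layer N j) c.
Proof.
move=> cN Ne0.
have cNj j : c *m N ^+ j = N ^+ j *m c by exact: (@commrX _ c N j cN).
suff H : forall k, rdet 1%:M c = \prod_(j < k) rdet (layer N j) c * rdet (N ^+ k) c.
  by rewrite -rdet1 (H e) Ne0 rdet0 mulr1.
elim=> [|k IH]; first by rewrite big_ord0 mul1r.
rewrite IH big_ord_recr /= -mulrA; congr (_ * _).
rewrite exprSr; apply: rdet_split cN _.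
by rewrite -cNj submxMl.
Qed.

Lemma layerS n (N : 'M[F]_n) j : (layer N j.+1 <= layer N j)%MS.
Proof. by apply: capmxS => //; rewrite exprS submxMl. Qed.

Lemma rank_layer n (N : 'M[F]_n) j :
  (\rank (N ^+ j.+1) + \rank (layer N j))%N = \rank (N ^+ j).
Proof. by rewrite exprSr; apply: mxrank_mul_ker. Qed.

Lemma layer_stable n (c N : 'M[F]_n) j : c *m N = N *m c ->
  (layer N j *m c <= layer N j)%MS.
Proof.
move=> cN; have cNj : c *m N ^+ j = N ^+ j *m c by exact: (@commrX _ c N j cN).
rewrite sub_capmx (submx_trans (submxMr c (capmxSl _ _))) -?cNj ?submxMl //=.
apply/sub_kermxP; rewrite -mulmxA cN mulmxA.
by have /sub_kermxP-> := capmxSr (N ^+ j) (kermx N); rewrite mul0mx.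
Qed.

(** Layers decrease with the index, so equal ranks force equal spaces. *)
Lemma rdet_layer_eq n (c N : 'M[F]_n) i j : c *m N = N *m c ->
  (i <= j)%N -> \rank (layer N i) = \rank (layer N j) ->
  rdet (layer N j) c = rdet (layer N i) c.
Proof.
move=> cN ij rij; apply: rdet_eqmx; first exact: layer_stable.
apply/eqmxP; rewrite -(mxrank_leqif_eq _) ?rij //.
elim: j ij {rij} => [|j IH]; first by rewrite leqn0 => /eqP->.
rewrite leq_eqVlt => /predU1P[->//|]; rewrite ltnS => /IH.
exact/submx_trans/layerS.
Qed.

End RestrictedDet.

(** * Surjectivity of norms of finite fields *)

Section Norm.
Variable F : finFieldType.
Implicit Types (p q a b d f g : {poly F}).

Lemma card_pchar_pow : exists r k, r \in [pchar F] /\ #|F| = (r ^ k)%N.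
Proof.
have [r pr charF] := finPcharP F; exists r, (logn r #|[set: F]|); split=> //.
rewrite -cardsT; apply: card_pgroup; apply: abelem_pgroup.
exact: fin_ring_pchar_abelem.
Qed.

Section Extension.
Variables (L : finFieldType) (iota : {rmorphism F -> L}).

Lemma frobD (x y : L) : (x + y) ^+ #|F| = x ^+ #|F| + y ^+ #|F|.
Proof.
have [r [k [charF ->]]] := card_pchar_pow.
have charL : r \in [pchar L] by rewrite (fmorph_pchar iota).
elim: k => [|k IH]; first by rewrite expn0 !expr1.
by rewrite expnSr !exprM IH -!(pFrobenius_autE charL) rmorphD.
Qed.

(** Raising to the power [#|F|] is a ring endomorphism of [L] that fixes the image of [F], hence the
    coefficients. *)
Lemma root_frob p w :
  root (map_poly iota p) w -> root (map_poly iota p) (w ^+ #|F|).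
Proof.
have E : (map_poly iota p).[w ^+ #|F|] = (map_poly iota p).[w] ^+ #|F|.
  elim/poly_ind: p => [|p c IH].
    by rewrite rmorph0 !horner0 expr0n; case: #|F| (finNzRing_gt1 F).
  rewrite rmorphD rmorphM /= map_polyX map_polyC /= !hornerE IH frobD exprMn.
  by rewrite -[c in LHS]expf_card rmorphXn.
by rewrite !rootE E => /eqP->; rewrite expr0n; case: #|F| (finNzRing_gt1 F).
Qed.

End Extension.

Lemma hmx_comp n (A : 'M[F]_n) p q : hmx A (p \Po q) = hmx (hmx A q) p.
Proof.
elim/poly_ind: p => [|p c IH]; first by rewrite comp_poly0 !hmx0.
by rewrite comp_polyD comp_polyM comp_polyX comp_polyC !hmxD !hmxM IH !hmxX !hmxC.
Qed.

Lemma hmx_char n (A : 'M[F]_n) : hmx A (char_poly A) = 0.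
Proof. by case: n A => [|n] A; [rewrite [LHS]flatmx0|rewrite hmxE Cayley_Hamilton]. Qed.

Lemma det_hmxX n (A : 'M[F]_n) p k : \det (hmx A (p ^+ k)) = \det (hmx A p) ^+ k.
Proof.
elim: k => [|k IH]; first by rewrite hmx1 det1.
by rewrite !exprS hmxM det_mulmx IH.
Qed.

(* A generator [om] of the multiplicative group of [F['X] / (f)] has the distinct
   conjugates [om ^+ (q ^ j)], [j < d], so its norm is
   [om ^+ ((q ^ d - 1) / (q - 1))], which generates the multiplicative group of [F]. *)
Lemma norm_surj f (d : nat) (G : 'M[F]_d) x : monic_irred f -> deg f = d -> hmx G f = 0 ->
  x != 0 -> exists p, \det (hmx G p) = x.
Proof.
move=> fi fd Gf x0; have [irr mon] := monic_irredP _ fi.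
have d0 : (0 < d)%N by rewrite -fd monic_irred_deg.
have hI : monic_irreducible_poly f by split.
pose L : finFieldType := {poly %/ f with hI}.
pose ev : {rmorphism {poly F} -> L} := in_qpoly f.
pose em : {rmorphism F -> L} := ev \o polyC.
have cardL : #|L| = (#|F| ^ d)%N by rewrite card_qfpoly fd.
have q1 : (1 < #|F|)%N := finNzRing_gt1 F.
have [w wE] : exists w : {unit L}, [set: {unit L}] = <[w]>%g.
  exact/cyclicP/field_unit_group_cyclic.
have ow : #[w]%g = (#|F| ^ d).-1 by rewrite /order -wE card_finField_unit cardL.
set om : L := FinRing.uval w.
have [P evP] : exists P : {poly F}, ev P = om.
  exists (polyn (om : {poly %/ f})); apply: val_inj.
  exact: in_qpoly_small (size_mk_monic _).
have evf : ev f = 0.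
  apply: val_inj; rewrite /= (mk_monicE hI) -Pdiv.IdomainMonic.modpE // modpp.
  by [].
pose H := hmx G P; pose chi := char_poly H.
(* Both [f] and [chi(P)] vanish at [G]; were they coprime, a Bezout relation would make the identity
   matrix 0. Hence [om] is a root of [chi]. *)
have fchi : f %| chi \Po P.
  have Gchi : hmx G (chi \Po P) = 0 by rewrite hmx_comp hmx_char.
  apply: contraTT d0 => nf; rewrite -leqNgt leqn0 -[X in X == _](mxrank1 F).
  have : coprimep f (chi \Po P) by rewrite irreducible_poly_coprime.
  move=> /Bezout_eq1_coprimepP[[u v] /= E].
  by rewrite -(hmx1 G) -E hmxD !hmxM Gf Gchi !mulmx0 addr0 mxrank0.
have evE p : ev (p \Po P) = (map_poly em p).[om].
  elim/poly_ind: p => [|p c IH]; first by rewrite comp_poly0 !rmorph0 horner0.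
  rewrite comp_polyD comp_polyM comp_polyX comp_polyC rmorphD rmorphM IH evP.
  rewrite [X in _ = X.[om]]rmorphD [X in _ = (X + _).[om]]rmorphM /= map_polyX map_polyC.
  by rewrite !hornerE.
have root_om : root (map_poly em chi) om.
  by move/dvdpP: fchi => [g gE]; rewrite rootE -evE gE rmorphM /= evf mulr0.
have roots j : root (map_poly em chi) (om ^+ (#|F| ^ j)).
  elim: j => [|j IH]; first by rewrite expn0 expr1.
  by rewrite expnSr exprM root_frob.
have omX k : om ^+ k = FinRing.uval (w ^+ k)%g by rewrite FinRing.val_unitX.
pose rs := [seq om ^+ (#|F| ^ j) | j <- seq.iota 0 d].
have rs_uniq : uniq rs.
  have lt_neq i j : (i < j < d)%N -> om ^+ (#|F| ^ i) != om ^+ (#|F| ^ j).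
    case/andP=> ij jd; rewrite !omX (inj_eq val_inj) eq_sym eq_expg_mod_order.
    have le_ij : (#|F| ^ i <= #|F| ^ j)%N by rewrite leq_exp2l // ltnW.
    rewrite eqn_mod_dvd // ow; apply/negP => /dvdn_leq.
    have lt_ij : (#|F| ^ i < #|F| ^ j)%N by rewrite ltn_exp2l.
    have lt_jd : (#|F| ^ j < #|F| ^ d)%N by rewrite ltn_exp2l.
    have : (0 < #|F| ^ i)%N by rewrite expn_gt0 ltnW.
    by move: lt_ij lt_jd; move: (_ ^ i)%N (_ ^ j)%N (_ ^ d)%N => x' y z; lia.
  rewrite map_inj_in_uniq ?iota_uniq // => i j; rewrite !mem_iota /= !add0n => id jd.
  move=> /eqP E; apply/eqP; apply: contraTT E; rewrite neq_ltn => /orP[ij|ji].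
    by rewrite lt_neq // ij.
  by rewrite eq_sym lt_neq // ji.
have chiE : map_poly em chi = \prod_(z <- rs) ('X - z%:P).
  rewrite (@all_roots_prod_XsubC _ (map_poly em chi) rs).
  - rewrite lead_coef_map (monicP (char_poly_monic H)) rmorph1 scale1r //.
  - by rewrite size_map_poly size_char_poly size_map size_iota.
  - by apply/allP => z /mapP[j _ ->]; apply: roots.
  - by rewrite uniq_rootsE.
pose s := (\sum_(j < d) #|F| ^ j)%N.
have emdet : em (\det H) = om ^+ s.
  have E : em chi.[0] = (\prod_(z <- rs) ('X - z%:P)).[0].
    by rewrite -chiE -[in RHS](rmorph0 em) horner_map.
  move: E; rewrite horner_prod horner_coef0 /chi char_poly_det.
  rewrite [LHS]rmorphM [X in X * _]rmorphXn [X in X ^+ _]rmorphN1.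
  rewrite big_map -[X in seq.iota 0 X]subn0 -/(index_iota 0 d) big_mkord => E.
  apply: (@mulfI _ ((-1) ^+ d)); first by rewrite signr_eq0.
  rewrite E expr_sum -[d in (-1) ^+ d]card_ord -prodrN; apply: eq_bigr => j _.
  by rewrite !hornerE.
have y0 : \det H != 0 by rewrite -(fmorph_eq0 em) emdet expf_neq0 // -unitfE (valP w).
pose y := FinRing.unit F (etrans (unitfE _) y0).
(* As [om] has order [q^d - 1 = (q - 1) s], the equation [om^(s r) = 1] forces [q - 1] to divide
   [r]. *)
have oy : (#|F|.-1 %| #[y]%g)%N.
  have : om ^+ (s * #[y]%g) = 1.
    by rewrite exprM -emdet -rmorphXn -[\det H]/(FinRing.uval y)
      -FinRing.val_unitX expg_order rmorph1.
  rewrite omX -FinRing.val_unit1 => /val_inj/eqP; rewrite -order_dvdn ow predn_exp mulnC.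
  by rewrite dvdn_pmul2l // /s (bigD1 (Ordinal d0)) //= expn0.
have yT : [set: {unit F}] = <[y]>%g.
  by apply/esym/eqP; rewrite eqEcard subsetT card_finField_unit dvdn_leq.
have : FinRing.unit F (etrans (unitfE _) x0) \in [set: {unit F}] by rewrite inE.
rewrite yT => /cycleP[k /(congr1 (@FinRing.uval F))]; rewrite FinRing.val_unitX /= => ->.
by exists (P ^+ k); rewrite det_hmxX.
Qed.

End Norm.

(** * The determinants of the centralizer of a matrix *)

Section CentralizerDet.
Variable F : finFieldType.
Implicit Types (p q a b f g : {poly F}).

(** The first [i] layers of [N = f(C)] all have dimension [deg f], so they coincide and [det p(C)]
    is the [i]-th power of the determinant of [p(G)], where [G] is the action of [C] on the layer 0.
    Since [f(G) = 0], that determinant is a norm and can be prescribed. *)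
Lemma det_hmx_cyc_exp k (C : 'M[F]_k) f i x : monic_irred f -> (0 < i)%N -> cyc C (f ^+ i) ->
  x != 0 -> exists p, \det (hmx C p) = x ^+ i.
Proof.
move=> fi i0 [v Cv] x0; pose N := hmx C f.
have sz : k = (deg f * i)%N by case: Cv => _ sz _ _; rewrite -size_exp sz.
have rN j : (j <= i)%N -> \rank (N ^+ j) = (deg f * (i - j))%N.
  move=> ji; rewrite -hmxXn (cyc_rank Cv) deg_gcd_pow // eqxx (minn_idPl ji) sz.
  by rewrite [(j * _)%N]mulnC -mulnBr.
have rL j : (j < i)%N -> \rank (layer N j) = deg f.
  move=> ji; have := rank_layer N j; rewrite !rN ?(ltnW ji) //.
  by rewrite -(subnSK ji) mulnS addnC => /addIn.
have Ni : N ^+ i = 0 by apply/eqP; rewrite -mxrank_eq0 rN // subnn muln0.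
have CN : C *m N = N *m C by apply: hmx_inter.
set B := row_base (layer N 0).
pose G := B *m C *m pinvmx B.
have BC : B *m C = G *m B.
  by rewrite mulmxKpV // (eqmxMr C (eq_row_base _)) eq_row_base layer_stable.
have Gf : hmx G f = 0.
  have : hmx G f *m B = 0.
    rewrite -(hmx_inter _ BC); apply/sub_kermxP.
    by rewrite eq_row_base capmxSr.
  by move/eqP; rewrite mulmx_free_eq0 ?row_base_free // => /eqP.
have [p pE] := norm_surj fi (esym (rL 0%N i0)) Gf x0.
exists p; rewrite -pE (@det_layers _ _ _ N i) //; last by apply: hmxMC.
have -> : \det (hmx G p) = rdet (layer N 0) (hmx C p).
  by rewrite (rdetE (row_base_free _) (eq_row_base _) (hmx_inter p BC)).
rewrite -[X in _ ^+ X]card_ord -prodr_const; apply: eq_bigr => j _.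
by apply: rdet_layer_eq; rewrite ?rL //; apply: hmxMC.
Qed.

Lemma mult_poly_neq1 l i : all (@prim_pair F) l -> mult_poly l i != 1 ->
  exists2 f, monic_irred f & (f, i) \in l.
Proof.
move=> lp; case: (boolP (has (fun x => x.2 == i) l)) => [/hasP[[f j] fl /eqP/= ji] _|no].
  by exists f; rewrite -?ji //; have /andP[] := allP lp _ fl.
rewrite /mult_poly big_seq_cond big_pred0 ?eqxx // => x; apply/negP => /andP[xl xi].
by case/negP: no; apply/hasP; exists x.
Qed.

Lemma mem_mult_poly_neq1 l f i : monic_irred f -> (f, i) \in l -> mult_poly l i != 1.
Proof.
move=> fi fl; apply/eqP => u1; have : f %| mult_poly l i.
  by rewrite /mult_poly (big_rem _ fl) /= eqxx dvdp_mulr.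
by rewrite u1 (dvdp1 f) => /eqP f1; have := monic_irred_deg fi; rewrite f1.
Qed.

(** The commuting matrix acts as a polynomial in [C] on one block [C] with annihilator [f^i] and as
    the identity on the rest. *)
Lemma centralizer_det_ge n (A : 'M[F]_n) i x : (0 < i)%N -> type_poly A i != 1 -> x != 0 ->
  exists2 c, c *m A = A *m c & \det c = x ^+ i.
Proof.
move=> i0 ui x0; have [l Al] := primary_exist A; case: (Al) => lp Ab.
move: ui; rewrite (type_polyE Al i0) => /(mult_poly_neq1 lp)[f fi fl].
have Ab' : blocks A (f ^+ i :: map (@prime_pow F) (rem (f, i) l)).
  case: Ab => mon rk; have P := perm_map (@prime_pow F) (perm_to_rem fl).
  by split=> [|p]; [rewrite -(perm_all _ P) | rewrite -(rank_profile_perm _ P)].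
have [k [C [m [A' [Ca _ CA]]]]] := blocks_cons Ab'.
have [p pE] := det_hmx_cyc_exp fi i0 Ca x0.
have mn := sim_dim CA; case: n / mn A CA {Al lp Ab Ab' fl} => A /sim_unit[P Pu PA].
pose D := block_mx (hmx C p) 0 0 (1%:M : 'M[F]_m).
have CD : D *m block_mx C 0 0 A' = block_mx C 0 0 A' *m D.
  rewrite !mulmx_block !(mulmx0, mul0mx, addr0, add0r, mulmx1, mul1mx).
  by rewrite (@hmx_inter _ _ _ C C C).
exists (invmx P *m D *m P).
  have APi : A *m invmx P = invmx P *m block_mx C 0 0 A'.
    by apply: (can_inj (mulKmx Pu)); rewrite mulmxA PA mulmxK // mulKVmx.
  by rewrite -(mulmxA _ P A) PA !mulmxA APi -(mulmxA (invmx P) D) CD mulmxA.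
by rewrite !det_mulmx mulrAC -det_mulmx mulVmx // det1 mul1r det_ublock det1 mulr1.
Qed.

Lemma prod_blockwise_const (E : nat -> F) d m :
  (forall j, ~~ (d %| j.+1)%N -> E j.+1 = E j) ->
  \prod_(j < d * m) E j = (\prod_(k < m) E (d * k)%N) ^+ d.
Proof.
move=> EE; elim: m => [|m IH]; first by rewrite muln0 !big_ord0 expr1n.
rewrite big_ord_recr exprMn -IH /= -!(big_mkord xpredT E) mulnS addnC.
rewrite (@big_cat_nat _ _ _ (d * m)%N) ?leq_addr //=; congr (_ * _).
have -> : E (d * m)%N ^+ d = \prod_(d * m <= j < d * m + d) E (d * m)%N.
  by rewrite prodr_const_nat addKn.
apply: eq_big_nat => j /andP[dj jd]; rewrite -(subnKC dj).
have : (j - d * m < d)%N by rewrite ltn_subLR.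
elim: (j - _)%N => [|r IHr] rd; first by rewrite addn0.
rewrite addnS EE ?IHr // ?(ltnW rd) //.
by rewrite -addnS dvdn_addr ?dvdn_mulr // gtnNdvd.
Qed.

Lemma centralizer_det_le n (A c : 'M[F]_n) d : (0 < d)%N ->
  (forall i, (0 < i)%N -> type_poly A i != 1 -> (d %| i)%N) ->
  c *m A = A *m c -> exists y, \det c = y ^+ d.
Proof.
move=> d0 du cA; have [l Al] := primary_exist A; case: (Al) => lp [_ Ar].
pose P := \prod_(f <- undup (map fst l)) f; pose N := hmx A P.
have gcdE x j : x \in l -> deg (gcdp (P ^+ j) (prime_pow x)) = (minn j x.2 * deg x.1)%N.
  case: x => [f i] xl; have /andP[/= fi i0] := allP lp _ xl.
  have fU : f \in undup (map fst l) by rewrite mem_undup; apply: (map_f fst xl).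
  rewrite /P (big_rem _ fU) /= exprMn mulrC; set Q := \prod_(_ <- _) _.
  have fQ : coprimep f Q.
    have [irr _] := monic_irredP _ fi; rewrite irreducible_poly_coprime //.
    apply/negP => /(monic_irred_dvd_prod fi) => H.
    have : f \in rem f (undup [seq i.1 | i <- l]).
      apply: H; apply/allP => g /mem_rem; rewrite mem_undup => /mapP[y yl ->].
      by have /andP[] := allP lp _ yl.
    by rewrite mem_rem_uniq ?undup_uniq // !inE eqxx.
  rewrite (deg_eqp (gcdpC _ _)) (deg_eqp (Gauss_gcdpr _ _)) ?coprimep_expl ?coprimep_expr //.
  by rewrite (deg_eqp (gcdpC _ _)) deg_gcd_pow // eqxx.
have rN j : \rank (N ^+ j) = rank_profile (map (@prime_pow F) l) (P ^+ j) by rewrite -hmxXn Ar.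
(* [N^n] is already 0; the exponent is a multiple of [d] so that the layers fall into whole groups
   of [d]. *)
have Ne : N ^+ (d * n) = 0.
  apply/eqP; rewrite -mxrank_eq0 rN /rank_profile big_map big_seq big1 // => x xl.
  rewrite gcdE // size_exp; have [/andP[x0 xn] _] := primary_bound Al xl.
  by rewrite (minn_idPr _) ?(leq_trans xn) ?leq_pmull // mulnC subnn.
have cN : c *m N = N *m c by apply: hmx_inter.
rewrite (det_layers cN Ne) (prod_blockwise_const (E := fun j => rdet (layer N j) c)).
  by eexists.
move=> j dj; apply: rdet_layer_eq => //.
(* The ranks of the layers [j] and [j + 1] differ by a second difference of ranks of powers of [N],
   which vanishes unless [j + 1] is an exponent of an elementary divisor and hence a multiple of
   [d]. *)
have sd := @rank_profile_second_diff _ l predT P j.+1 isT lp (fun x k xl => gcdE x k xl).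
move: sd; rewrite /= big_seq_cond big_pred0 ?addn0 -?rN; last first.
  move=> [f i] /=; apply/negP => /andP[fl /eqP ij]; move: fl; rewrite ij => fl.
  have /andP[fi _] := allP lp _ fl; case/negP: dj; apply: du => //.
  by rewrite (type_polyE Al) //; apply: mem_mult_poly_neq1 fi fl.
rewrite -(rank_layer N j) -(rank_layer N j.+1).
move: (\rank (N ^+ j.+2)) (\rank (layer N j)) (\rank (layer N j.+1)) => x y z; lia.
Qed.

End CentralizerDet.

(** * Reversing involutions *)

Section Reversing.
Variable F : finFieldType.
Implicit Types (p q a b f g : {poly F}).

Definition reverser n (A : 'M[F]_n) e :=
  exists h, [/\ h *m h = 1%:M, h *m A = invmx A *m h & \det h = e].

Lemma reverser_sim m n (A : 'M[F]_m) (B : 'M[F]_n) e : A \in unitmx -> sim A B ->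
  reverser A e -> reverser B e.
Proof.
move=> Au AB; have mn := sim_dim AB; case: n / mn B AB => B.
move=> /[dup] /sim_in_unit ABu; rewrite Au in ABu.
move=> /sim_unit[P Pu PB] [h [hh hA he]].
have BE : B = invmx P *m A *m P by rewrite -mulmxA -PB mulKmx.
have BiE : invmx B = invmx P *m invmx A *m P.
  apply: (can_inj (mulKmx (esym ABu))); rewrite mulmxV -?ABu // BE !mulmxA.
  by rewrite (mulmxK Pu) (mulmxK Au) mulVmx.
exists (invmx P *m h *m P); split.
- by rewrite !mulmxA (mulmxK Pu) -(mulmxA _ h h) hh mulmx1 mulVmx.
- by rewrite BiE BE !mulmxA !(mulmxK Pu) -(mulmxA _ h A) hA mulmxA.
by rewrite !det_mulmx mulrAC -det_mulmx mulVmx // det1 mul1r.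
Qed.

Lemma reverser_block m n (A : 'M[F]_m) (B : 'M[F]_n) e e' :
  A \in unitmx -> B \in unitmx ->
  reverser A e -> reverser B e' -> reverser (block_mx A 0 0 B) (e * e').
Proof.
move=> Au Bu [h [hh hA <-]] [k [kk kB <-]]; exists (block_mx h 0 0 k).
rewrite block_inv // !mulmx_block !(mulmx0, mul0mx, addr0, add0r) hh kk hA kB.
by rewrite -scalar_mx_block det_ublock.
Qed.

Section Cyclic.
Variables (k : nat) (C : 'M[F]_k) (a : {poly F}) (v : 'rV[F]_k) (h : 'M[F]_k).
Hypotheses (Cu : C \in unitmx) (Cv : cyc_vec C a v) (Cv' : cyc_vec (invmx C) a v).

Hypothesis hE : krylov v C k *m h = krylov v (invmx C) k.

Lemma cyc_vec_ext (M M' : 'M[F]_k) :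
  (forall p, v *m hmx C p *m M = v *m hmx C p *m M') -> M = M'.
Proof.
move=> E; apply/row_matrixP => i; rewrite !rowE.
by have [p _ ->] := cyc_vec_surj Cv (delta_mx 0 i).
Qed.

(** For [p] of size at most [k] this is the definition of [h]. In general only [p] modulo [a]
    matters, because [v] has the same annihilator [a] for [C] and for its inverse. *)
Lemma cyc_revE p : v *m hmx C p *m h = v *m hmx (invmx C) p.
Proof.
have [_ sz va Ku] := Cv; have [_ _ va' _] := Cv'.
have a0 : a != 0 by rewrite -size_poly_gt0 sz.
have szm : (size (p %% a)%R <= k)%N by rewrite -ltnS -sz ltn_modp.
rewrite {1 2}(divp_eq p a) !hmxD !hmxM !mulmxDr !(hmxMC _ _ a) !mulmxA va va' !mul0mx.
by rewrite !add0r -!(poly_krylov _ _ szm) -mulmxA hE.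
Qed.

Lemma cyc_rev_mid : C *m h *m C = h.
Proof.
apply: cyc_vec_ext => p; rewrite !mulmxA. rewrite cyc_revE.
have -> : v *m hmx C p *m C = v *m hmx C (p * 'X) by rewrite hmxM hmxX mulmxA.
by rewrite cyc_revE hmxM hmxX !mulmxA mulmxKV.
Qed.

Lemma cyc_rev_comm : h *m C = invmx C *m h.
Proof. by rewrite -[in RHS]cyc_rev_mid !mulmxA mulVmx // mul1mx. Qed.

Lemma cyc_rev_invol : h *m h = 1%:M.
Proof.
have vh : v *m h = v by have := cyc_revE 1; rewrite !hmx1 !mulmx1.
apply: cyc_vec_ext => p; rewrite mulmxA cyc_revE mulmx1 -mulmxA.
by rewrite -(hmx_inter p cyc_rev_comm) mulmxA vh.
Qed.

Lemma cyc_rev_det : \det h = 1 \/ \det h = -1.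
Proof.
have := congr1 determinant cyc_rev_invol; rewrite det_mulmx det1 -expr2 => /eqP.
by rewrite sqrf_eq1 => /orP[] /eqP; [left|right].
Qed.

(** A second reversing involution of opposite determinant is [- h] when [k] is odd, and [C *m h]
    when [C] has determinant -1. *)
Lemma cyc_rev_full : odd k || (\det C == -1) -> reverser C 1 /\ reverser C (-1).
Proof.
move=> kC; suff [h' [h'h' h'C h'd]] : exists h', [/\ h' *m h' = 1%:M,
    h' *m C = invmx C *m h' & \det h' = - \det h].
  have Rh : reverser C (\det h) by exists h; rewrite cyc_rev_invol cyc_rev_comm.
  have Rh' : reverser C (- \det h) by exists h'; rewrite h'h' h'C h'd.
  by case: cyc_rev_det Rh Rh' => ->; rewrite ?opprK.
case/orP: kC => [ko|/eqP dC].
  exists (- h); split; rewrite ?mulNmx ?mulmxN ?opprK ?cyc_rev_invol ?cyc_rev_comm //.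
  by rewrite -[- h]scaleN1r detZ -signr_odd ko expr1 mulN1r.
exists (C *m h); split.
- by rewrite mulmxA cyc_rev_mid cyc_rev_invol.
- by rewrite cyc_rev_mid mulmxA mulVmx // mul1mx.
- by rewrite det_mulmx dC mulN1r.
Qed.

Lemma cyc_rev_shift j : v *m invmx C ^+ j *m h = v *m C ^+ j.
Proof.
have := cyc_revE 'X^j; rewrite !hmxXn !hmxX => <-.
by rewrite -mulmxA cyc_rev_invol mulmx1.
Qed.

End Cyclic.

Lemma det_swap m : \det (block_mx 0 1%:M 1%:M 0 : 'M[F]_(m + m)) = (-1) ^+ m.
Proof.
(* [U] has determinant 1 and brings the swap to block triangular form with diagonal blocks 1 and
   -1. *)
pose U : 'M[F]_(m + m) := block_mx 1%:M 0 (- 1%:M) 1%:M *m block_mx 1%:M 1%:M 0 1%:M.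
have : \det (U *m block_mx 0 1%:M 1%:M 0) = (-1) ^+ m.
  rewrite /U -mulmxA !mulmx_block !(mulmx0, mul0mx, addr0, add0r, mulmx1, mul1mx, mulNmx).
  by rewrite addNr det_ublock det1 mul1r -scaleN1r detZ det1 mulr1.
by rewrite det_mulmx /U det_mulmx det_lblock det_ublock !det1 !mul1r.
Qed.

Lemma cyc_rev_even m (C : 'M[F]_(m + m)) a v h :
  krylov v C (m + m) *m h = krylov v (invmx C) (m + m) ->
  C \in unitmx -> cyc_vec C a v -> cyc_vec (invmx C) a v -> \det C = 1 ->
  reverser C ((-1) ^+ m).
Proof.
move=> hE Cu Cv Cv' dC.
(* [h *m C] maps [v C^j] to [v C^(1-j)]: it exchanges the vectors with exponents
   1, ..., m with those with exponents 0, ..., 1 - m. *)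
have mid : C *m h *m C = h := cyc_rev_mid Cu Cv Cv' hE.
have hh : h *m h = 1%:M := cyc_rev_invol Cu Cv Cv' hE.
pose Q := col_mx (krylov v C m *m C) (krylov v (invmx C) m).
have hj j : v *m invmx C ^+ j *m h = v *m C ^+ j := cyc_rev_shift Cu Cv Cv' hE j.
have hj' j : v *m C ^+ j *m h = v *m invmx C ^+ j by rewrite -hj -mulmxA hh mulmx1.
have Qh : Q *m (h *m C) = block_mx 0 1%:M 1%:M 0 *m Q.
  rewrite mul_col_mx mul_block_col !mul0mx !mul1mx addr0 add0r.
  congr col_mx; apply/row_matrixP => j; rewrite !row_mul !rowK.
    by rewrite -mulmxA (mulmxA C) mid hj'.
  by rewrite mulmxA hj.
have Qu : Q \in unitmx.
  rewrite -row_free_unit; apply/inj_row_free => u; rewrite -[u]hsubmxK mul_row_col.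
  rewrite mulmxA !mul_krylov; set p := rVpoly _; set q := rVpoly _ => E.
  suff [p0 q0] : p = 0 /\ q = 0.
    have u1 : lsubmx u = 0 by apply: (can_inj rVpolyK); rewrite raddf0.
    have u2 : rsubmx u = 0 by apply: (can_inj rVpolyK); rewrite raddf0.
    by rewrite u1 u2 row_mx0.
  have [mon sz _ _] := Cv.
  have szp : (size p <= m)%N := size_poly _ _.
  have szq : (size q <= m)%N := size_poly _ _.
  case: m C v h {mon hE Cv' dC mid hh hj hj' Q Qh u} Cu Cv sz p q E szp szq
    => [|m] C v h Cu Cv sz p q E szp szq.
    by move: szp szq; rewrite !leqn0 !size_poly_eq0 => /eqP-> /eqP->.
  (* Here [m] has been replaced by [m.+1]. Multiplying by [C^m] clears the negative exponents; the
     resulting polynomial has smaller degree than [a], so it is 0, and its two summands have no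
     degree in common. *)
  have: v *m hmx C (p * 'X^(m.+1) + revp m q) = 0.
    have := congr1 (mulmx^~ (hmx C 'X^m)) E; rewrite mul0mx mulmxDl -!mulmxA.
    rewrite -(@hmx_inter _ _ _ (hmx C 'X^m) (invmx C) (invmx C)); last first.
      by apply/esym/hmx_inter; rewrite mulmxV // mulVmx.
    have -> : C *m hmx C 'X^m = hmx C 'X^(m.+1) by rewrite exprS hmxM hmxX.
    by rewrite hmx_inv // -hmxM -mulmxDr -hmxD.
  move=> /eqP; rewrite (cyc_vec_dvd Cv) => aw.
  have szr : (size (revp m q) <= m.+1)%N := size_poly _ _.
  have w0 : p * 'X^(m.+1) + revp m q = 0.
    apply: contraTeq aw => w0; apply/negP => /dvdp_leq => /(_ w0).
    rewrite sz leqNgt ltnS (leq_trans (size_polyD _ _)) // geq_max.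
    rewrite (leq_trans szr) ?leq_addr // andbT.
    by rewrite (leq_trans (size_mul_leq _ _)) // size_polyXn addnS leq_add2r.
  have p0 : p = 0.
    apply/eqP; apply: contraT => p0; move: szr.
    rewrite (_ : revp m q = - (p * 'X^(m.+1))); last first.
      by apply/eqP; rewrite -addr_eq0 addrC w0.
    by rewrite size_polyN size_mulXn // -[leqRHS]addn0 leq_add2l leqn0 size_poly_eq0 (negPf p0).
  split=> //; move: w0; rewrite p0 mul0r add0r => r0.
  by rewrite -(revpK szq) r0 revp0.
exists (h *m C); split.
- by rewrite mulmxA -(mulmxA h C h) -mulmxA mid hh.
- by rewrite -{2}mid !mulmxA mulVmx // mul1mx.
have := congr1 determinant Qh; rewrite [LHS]det_mulmx [RHS]det_mulmx det_swap mulrC.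
by apply: mulIf; rewrite -unitfE -unitmxE.
Qed.

(** [C] is similar to its inverse, so its determinant is 1 or -1. If [k] is even and the determinant
    is not -1, it is therefore 1 and [cyc_rev_even] applies; otherwise both signs are available. *)
Lemma cyc_reverser k (C : 'M[F]_k) a : C \in unitmx -> cyc C a -> recip a = a ->
  (reverser C 1 /\ reverser C (-1)) \/ ~~ odd k /\ reverser C ((-1) ^+ k./2).
Proof.
move=> Cu Ca aa; have a0 : a`_0 != 0 by rewrite -(cyc_char Ca) char_coef0.
have [v Cv] := Ca; have := cyc_inv Cu a0 Cv; rewrite aa => Cv'.
have [h hE] : exists h, krylov v C k *m h = krylov v (invmx C) k.
  exists (invmx (krylov v C k) *m krylov v (invmx C) k).
  by rewrite mulKVmx //; case: Cv.
have [kC|] := boolP (odd k || (\det C == -1)).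
  by left; apply: (cyc_rev_full Cu Cv Cv' hE).
rewrite negb_or => /andP[ke dC]; right; split=> //.
have dC1 : \det C = 1.
  have sCC : sim C (invmx C) by apply: cyc_sim Ca _; exists v.
  have := sim_char sCC => /(congr1 (fun p : {poly F} => p`_0)).
  rewrite !char_poly_det det_inv => /(mulfI _) E.
  have {}E : \det C = (\det C)^-1 by apply: E; rewrite signr_eq0.
  have : \det C ^+ 2 == 1.
    by rewrite expr2 {1}E mulVf // -unitfE -unitmxE.
  by rewrite sqrf_eq1 (negPf dC) orbF => /eqP.
have kE : k = (k./2 + k./2)%N by rewrite addnn -[LHS]odd_double_half (negPf ke).
move: (k./2) kE => m kE; subst k; exact: cyc_rev_even hE Cu Cv Cv' dC1.
Qed.

(** Split off the block of the minimal polynomial. Since [A] is similar to its inverse, this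
    polynomial is self-reciprocal, and cancelling ranks shows that the complement is similar to its
    inverse too. Determinants multiply, so one summand offering both signs is enough to obtain both
    for [A]. *)
Lemma exists_reverser n (A : 'M[F]_n) : A \in unitmx -> sim A (invmx A) ->
  (reverser A 1 /\ reverser A (-1)) \/ ~~ odd n /\ reverser A ((-1) ^+ n./2).
Proof.
elim/ltn_ind: n A => -[|n] IH A Au AA.
  right; split=> //; exists 1%:M; rewrite !mul1mx mulmx1 det1; split=> //.
  by rewrite [LHS]flatmx0 [RHS]flatmx0.
have [k [C [m [A' [k0 Ca CA]]]]] := cyclic_block A; set a := mxminpoly A in Ca.
have /andP[Cu A'u] : (C \in unitmx) && (A' \in unitmx).
  by rewrite -block_unit (sim_in_unit CA).
have CAu : block_mx C 0 0 A' \in unitmx by rewrite block_unit Cu.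
have a0 : a`_0 != 0 by rewrite -(cyc_char Ca) char_coef0.
have [v Cv] := Ca; have Cv' := cyc_inv Cu a0 Cv.
have sC : sim (block_mx (invmx C) 0 0 (invmx A')) (block_mx C 0 0 A').
  rewrite -block_inv //; apply: sim_trans (sim_invmx CA CAu) _.
  exact: sim_trans (sim_sym AA) (sim_sym CA).
have aa : recip a = a.
  have am : a \is monic := mxminpoly_monic A.
  apply/eqP; rewrite -eqp_monic ?recip_monic // -dvdp_size_eqp ?size_recip //.
  rewrite -(cyc_dvd Cv') -mxrank_eq0.
  have : \rank (hmx (block_mx (invmx C) 0 0 (invmx A')) a) == 0%N.
    by rewrite (sim_rank a sC) (sim_rank a CA) hmxE mx_root_minpoly mxrank0.
  by rewrite hmx_block rank_diag_block_mx addn_eq0 => /andP[].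
rewrite aa in Cv'; have sCC : sim C (invmx C) := cyc_sim Ca (ex_intro _ v Cv').
have sAA' : sim A' (invmx A').
  apply: rank_sim => p; have := sim_rank p sC.
  by rewrite !hmx_block !rank_diag_block_mx (sim_rank p sCC) => /addnI.
have nE : n.+1 = (k + m)%N by rewrite (sim_dim CA).
have mn : (m < n.+1)%N by rewrite nE -{1}[m]add0n ltn_add2r.
have A'r := IH m mn A' A'u sAA'.
have rev_sign l (B : 'M[F]_l) : (reverser B 1 /\ reverser B (-1)) \/
    ~~ odd l /\ reverser B ((-1) ^+ l./2) -> reverser B 1 \/ reverser B (-1).
  by case=> [[]|[_]]; [left | rewrite -signr_odd; case: odd; [right|left]].
have revA e e' : reverser C e -> reverser A' e' -> reverser A (e * e').
  by move=> Ce A'e; apply: reverser_sim CAu CA _; apply: reverser_block.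
case: (cyc_reverser Cu Ca aa) A'r => [[C1 C2] A'r|[ke Ce] [[A1 A2]|[me A'e]]].
- left; case: (rev_sign _ _ A'r) => A'e.
    by split; [rewrite -[1]mul1r|rewrite -[-1]mulr1]; apply: revA.
  by split; [rewrite -[1]mulr1 -mulrNN|rewrite -[-1]mul1r]; apply: revA.
- left; have [Ce'|Ce'] : reverser C 1 \/ reverser C (-1) by apply: rev_sign; right.
    by split; [rewrite -[1]mul1r|rewrite -[-1]mul1r]; apply: revA.
  by split; [rewrite -[1]mulr1 -mulrNN|rewrite -[-1]mulr1]; apply: revA.
right; split; first by rewrite nE oddD (negPf ke) (negPf me).
rewrite (congr1 half nE) halfD (negPf ke) (negPf me) add0n exprD; exact: revA.
Qed.

End Reversing.

(** * Counting self-reciprocal polynomials *)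

Section CountSelfReciprocal.
Variables (F : finFieldType) (n : nat).
Implicit Types (p : {poly F}) (e : F).

Definition self_recip p := [&& p \is monic, p`_0 != 0 & recip p == p].

Lemma self_recipP p d : size p = d.+1 ->
  reflect (p`_d = 1 /\ p`_0 != 0 /\
           forall i, (i <= d)%N -> p`_(d - i) = p`_0 * p`_i) (self_recip p).
Proof.
move=> sz; apply: (iffP and3P) => [[mon p0 /eqP rp]|[pd [p0 ps]]].
  split; first by have := monicP mon; rewrite /lead_coef sz.
  split=> // i id; have := congr1 (fun r : {poly F} => r`_i) rp.
  by rewrite /recip sz coefZ coef_revp id /= => <-; rewrite mulVKf.
split=> //; first by rewrite monicE /lead_coef sz pd.
apply/eqP/polyP => i; rewrite /recip sz coefZ coef_revp; case: leqP => id.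
  by rewrite ps // mulKf.
by rewrite mulr0 nth_default // sz.
Qed.

(** By symmetry at index 0, the square of the constant term is the leading coefficient. *)
Lemma self_recip_coef0 p : self_recip p -> p`_0 = 1 \/ p`_0 = -1.
Proof.
move=> sp; have p0 : p != 0 by case/and3P: sp => /monic_neq0.
have sz : size p = (size p).-1.+1 by rewrite prednK // size_poly_gt0.
have [pd [_ ps]] := self_recipP sz sp; have := ps 0%N isT; rewrite subn0 pd -expr2 => /esym/eqP.
by rewrite sqrf_eq1 => /orP[] /eqP; [left|right].
Qed.

Definition self_recip_set d e := [set p : {poly_n.+1 F} |
  [&& self_recip p, size (p : {poly F}) == d.+1 & (p : {poly F})`_0 == e]].

(** The coefficient of degree [k] is [c_(k-1)] for [k] from 1 to [m], its mirror image at [d - k] is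
    [e] times that, and a middle coefficient left over is 0. *)
Definition sympoly d e m (c : {poly F}) : {poly F} := \poly_(k < d.+1)
  (if k == 0%N then e else if k == d then 1 else if (k <= m)%N then c`_k.-1
   else if (d - k <= m)%N then e * c`_(d - k).-1 else 0).

(* [m] is the number of free coefficients, namely those of degree 1 to [m]. *)
Lemma card_self_recip_set_free d e m : (0 < d <= n)%N -> e ^+ 2 = 1 ->
  (m.*2 <= d)%N -> (m < d)%N -> (m.*2 = d -> e = 1) ->
  (forall k, (m < k < d)%N -> (d - k <= m)%N \/
     (d = k.*2 /\ forall x : F, x = e * x -> x = 0)) ->
  #|self_recip_set d e| = (#|F| ^ m)%N.
Proof.
move=> /andP[d0 dn] ee md m_d m2 mid.
have e0 : e != 0 by apply: contra_eq_neq ee => ->; rewrite expr0n eq_sym oner_eq0.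
pose g (c : {poly_m F}) : {poly_n.+1 F} := npolyp n.+1 (sympoly d e m c).
have gE c : g c = sympoly d e m c :> {poly F}.
  by rewrite npolypK // (leq_trans (size_poly _ _)).
have gk c k : (k <= d)%N -> (g c : {poly F})`_k =
    (if k == 0%N then e else if k == d then 1 else if (k <= m)%N then (c : {poly F})`_k.-1
    else if (d - k <= m)%N then e * (c : {poly F})`_(d - k).-1 else 0).
  by move=> kd; rewrite gE coef_poly ltnS kd.
have szg c : size (g c : {poly F}) = d.+1.
  apply/eqP; rewrite eqn_leq {1}gE size_poly /= ltnNge; apply/negP => sd.
  have := gk c d (leqnn d); rewrite nth_default // eqxx gtn_eqF // => /eqP.
  by rewrite eq_sym oner_eq0.
have g_inj : injective g.
  move=> c c' cc'; apply/npolyP => k; case: (ltnP k m) => km; last first.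
    by rewrite !nth_default // (leq_trans (size_npoly _)).
  have kd : (k.+1 <= d)%N by rewrite (leq_trans km) // ltnW.
  have := gk c _ kd; have := gk c' _ kd; rewrite cc' => -> /=.
  have -> : (k.+1 == d)%N = false by apply/eqP => kE; move: m_d km; lia.
  by rewrite km.
have <- : #|g @: [set: {poly_m F}]| = (#|F| ^ m)%N.
  by rewrite card_imset // cardsT card_npoly.
apply: eq_card => p; rewrite inE; apply/idP/imsetP => [/and3P[sp /eqP sz /eqP p0]|[c _ ->]].
  have [pd [_ ps]] := self_recipP sz sp; rewrite p0 in ps.
  exists (npolyp m (\poly_(i < m) (p : {poly F})`_i.+1)) => //.
  apply/npolyP => k; case: (leqP k d) => kd; last first.
    by rewrite !nth_default ?szg ?sz.
  rewrite gk // npolypK ?size_poly //.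
  case: eqVneq => [->|k0]; first by rewrite p0.
  case: eqVneq => [->|k_d]; first by rewrite pd.
  have k1 : (0 < k)%N by rewrite lt0n.
  case: leqP => km; first by rewrite coef_poly prednK // km.
  have kd' : (k < d)%N by rewrite ltn_neqAle k_d.
  case: leqP => dkm.
    have dk0 : (0 < d - k)%N by rewrite subn_gt0.
    by rewrite coef_poly prednK // dkm -ps ?leq_subr // subKn.
  have [||[dk ex]] := mid k; first by rewrite km.
    by rewrite leqNgt dkm.
  apply: ex; rewrite -{1}(subKn kd) ps; last by rewrite leq_subr.
  by rewrite dk -addnn addnK.
rewrite szg eqxx gk //= eqxx andbT; apply/(self_recipP (szg c)).
rewrite [X in X = 1]gk // [X in X != 0]gk //= eqxx gtn_eqF //; split=> //; split=> // i id.
rewrite gk ?leq_subr // [X in _ = _ * X]gk // [X in _ = X * _]gk //=.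
case: (eqVneq i 0%N) => [->|i0]; first by rewrite subn0 eqxx gtn_eqF // -expr2.
case: (eqVneq i d) => [->|i_d]; first by rewrite subnn eqxx mulr1.
have id' : (i < d)%N by rewrite ltn_neqAle i_d.
rewrite (_ : (d - i == 0)%N = false); last by rewrite subn_eq0 leqNgt id'.
rewrite (_ : (d - i == d)%N = false); last by move: i0 id; lia.
rewrite subKn //; case: (leqP (d - i) m) => dim; case: (leqP i m) => im.
- have dm : m.*2 = d by move: md dim im id; lia.
  have -> : (d - i = i)%N by move: dm dim im id; lia.
  by rewrite (m2 dm) mul1r.
- by rewrite mulrA -expr2 ee mul1r.
- by [].
by rewrite mulr0.
Qed.

End CountSelfReciprocal.

Section Counts.
Variables (F : finFieldType) (n : nat).
Implicit Types (e : F).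
Local Notation q := #|F|.

Lemma odd_card_field : odd q = ((1 : F) != -1).
Proof.
have [r [k [rF qE]]] := card_pchar_pow F.
have r_pr := pcharf_prime rF; have q1 := finNzRing_gt1 F.
have k0 : (0 < k)%N by case: k qE q1 => // ->.
have E : (1 == -1 :> F) = (2%N \in [pchar F]).
  by rewrite inE /= -subr_eq0 opprK.
rewrite E (pcharf_eq rF) inE /= qE oddX; case: k k0 {qE} => //= k _.
by case: eqP => [<-|r2] //=; case: (even_prime r_pr) => // rE; case: r2.
Qed.

Definition self_recip_all d := [set p : {poly_n.+1 F} |
  self_recip (p : {poly F}) && (size (p : {poly F}) == d.+1)].

Lemma self_recip_set_all d e :
  self_recip_set n d e = [set p in self_recip_all d | (p : {poly F})`_0 == e].
Proof. by apply/setP => p; rewrite !inE andbA. Qed.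

Lemma card_self_recip_set_odd d e : (d <= n)%N -> odd d -> e ^+ 2 = 1 ->
  #|self_recip_set n d e| = (q ^ d.-1./2)%N.
Proof.
move=> dn od ee; have d0 : (0 < d)%N by case: d od {dn}.
have dE := odd_double_half d.-1.
have oE : odd d.-1 = false.
  by rewrite -[in odd d.-1](prednK d0) /=; case: d d0 od {dn dE} => //= d _ /negPf.
rewrite oE add0n in dE.
by apply: card_self_recip_set_free => //;
  first [by rewrite d0 | by move=> *; lia | by move=> k ?; left; lia].
Qed.

Lemma card_self_recip_set_even d : (0 < d <= n)%N -> ~~ odd d ->
  #|self_recip_set n d (1 : F)| = (q ^ d./2)%N.
Proof.
move=> d0n ed; have dE := odd_double_half d; rewrite (negPf ed) add0n in dE.
apply: card_self_recip_set_free => //; rewrite ?expr1n //; lia.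
Qed.

(** The middle coefficient equals its own negative and so vanishes for odd [q], which leaves one
    free coefficient fewer than for constant term 1. *)
Lemma card_self_recip_set_even_neg d : odd q -> (0 < d <= n)%N -> ~~ odd d ->
  #|self_recip_set n d (-1 : F)| = (q ^ d./2.-1)%N.
Proof.
move=> oq d0n ed; have dE := odd_double_half d; rewrite (negPf ed) add0n in dE.
apply: card_self_recip_set_free => //; rewrite ?sqrrN ?expr1n //; try lia.
move=> k kd; case: (leqP (d - k) d./2.-1) => dk; [by left|right; split; first lia].
move=> x /eqP; rewrite mulN1r -addr_eq0 -mulr2n -mulr_natl mulf_eq0 => /orP[|/eqP//].
have -> : 2%:R = 1 - -1 :> F by rewrite opprK.
by rewrite subr_eq0 -[_ == _]negbK -odd_card_field oq.
Qed.

Lemma self_recip_all0 : self_recip_all 0 = [set npolyp n.+1 1].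
Proof.
apply/setP => p; rewrite !inE; apply/andP/eqP => [[sp /eqP sz]|->].
  apply/val_inj; rewrite /= npolypK ?size_poly1 //.
  have /and3P[mon _ _] := sp; move: mon; rewrite (size1_polyC (eq_leq sz)) monicE lead_coefC.
  by move=> /eqP->.
rewrite npolypK ?size_poly1 // /self_recip monic1 coef1 oner_eq0 /= recip1.
by rewrite eqxx.
Qed.

Lemma self_recip_all_split d (G : F -> rat) : odd q ->
  \sum_(p in self_recip_all d) G (p : {poly F})`_0 =
    #|self_recip_set n d (1 : F)|%:R * G 1 + #|self_recip_set n d (-1 : F)|%:R * G (-1).
Proof.
move=> oq; have n1 : (1 : F) != -1 by rewrite -odd_card_field.
rewrite (bigID (fun p : {poly_n.+1 F} => (p : {poly F})`_0 == 1)) /=; congr (_ + _).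
  rewrite (eq_bigr (fun=> G 1)); last by move=> p /andP[_ /eqP->].
  rewrite (eq_bigl (mem (self_recip_set n d (1 : F)))) ?sumr_const ?mulr_natl // => p.
  by rewrite self_recip_set_all !inE.
rewrite (eq_big (mem (self_recip_set n d (-1 : F))) (fun=> G (-1))).
- by rewrite sumr_const mulr_natl.
  move=> p; rewrite self_recip_set_all !inE; case: (boolP (self_recip _)) => //= sp; congr (_ && _).
  by have [->|->] := self_recip_coef0 sp; rewrite eqxx ?(negPf n1) // eq_sym n1.
move=> p /andP[]; rewrite inE => /andP[sp _].
by have [->|->//] := self_recip_coef0 sp; rewrite eqxx.
Qed.

Lemma card_self_recip_all d : (0 < d <= n)%N -> #|self_recip_all d| = nqd q d.
Proof.
move=> d0n; have /andP[d0 dn] := d0n; rewrite /nqd; case: (boolP (odd q)) => oq.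
  apply/eqP; rewrite -(eqr_nat rat) -sum1_card natr_sum.
  rewrite (self_recip_all_split d (fun=> 1%:R)) // !mulr1 -natrD eqr_nat; apply/eqP.
  case: (boolP (odd d)) => od.
    by rewrite !card_self_recip_set_odd ?sqrrN ?expr1n // addnn mul2n.
  rewrite card_self_recip_set_even // card_self_recip_set_even_neg //.
  have -> : d./2 = d./2.-1.+1 by move: od d0; case: d {d0n dn} => [|[|d]].
  by rewrite expnS mulSn addnC.
have n1 : (1 : F) = -1 by apply/eqP; rewrite -[_ == _]negbK -odd_card_field.
have -> : self_recip_all d = self_recip_set n d (1 : F).
  apply/setP => p; rewrite self_recip_set_all !inE; case: (boolP (self_recip _)) => //= sp.
  by have [->|->] := self_recip_coef0 sp; rewrite -?n1 eqxx andbT.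
case: (boolP (odd d)) => od; first by rewrite card_self_recip_set_odd ?expr1n.
by rewrite card_self_recip_set_even.
Qed.

(* A [rat]-valued copy of [e] in {1, -1}: for odd [q], averaging a product of such
   signs with [1] detects whether the product is [1]. *)
Definition sign_of e : rat := if e == 1 then 1 else -1.

Definition twist d i : rat :=
  \sum_(p in self_recip_all d) sign_of ((-1) ^+ d * (p : {poly F})`_0) ^+ i.

(** For odd [i] this is the difference of the numbers of polynomials with either sign: these are
    equal for odd [d], and they are [q^(d/2)] and [q^(d/2-1)] for even [d]. For even [i] every sign
    becomes 1. *)
Lemma twistE d i : odd q -> (0 < d <= n)%N -> twist d i =
  if odd i then (if odd d then 0 else (q.-1 * q ^ d./2.-1)%:R) else (nqd q d)%:R.
Proof.
move=> oq d0n; have /andP[d0 dn] := d0n.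
have n1 : (-1 == 1 :> F) = false by rewrite eq_sym; apply/negbTE; rewrite -odd_card_field.
case: ifPn => oi; last first.
  rewrite -card_self_recip_all // -sum1_card natr_sum; apply: eq_bigr => p _.
  rewrite /sign_of; case: ifP => _; first by rewrite expr1n.
  by rewrite -signr_odd (negPf oi).
have sgi e : sign_of e ^+ i = sign_of e.
  by rewrite /sign_of; case: ifP; rewrite ?expr1n // -signr_odd oi.
rewrite /twist (eq_bigr (fun p : {poly_n.+1 F} =>
  sign_of ((-1) ^+ d * (p : {poly F})`_0))); last by [].
rewrite (self_recip_all_split d (fun x => sign_of ((-1) ^+ d * x))) // -signr_odd.
case: (boolP (odd d)) => od; rewrite /= ?expr1 ?expr0 !mulrN !mulr1 ?mul1r ?opprK /sign_of eqxx n1.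
  by rewrite !card_self_recip_set_odd ?sqrrN ?expr1n // mulrN1 mulr1 addNr.
rewrite card_self_recip_set_even // card_self_recip_set_even_neg //.
have -> : d./2 = d./2.-1.+1 by move: od d0; case: d {d0n dn} => [|[|d]].
rewrite mulr1 mulrN1 /= expnS -(subn1 #|F|) mulnBl mul1n natrB //.
by rewrite leq_pmull // ltnW // finNzRing_gt1.
Qed.

Lemma twist0 i : twist 0 i = 1.
Proof.
rewrite /twist self_recip_all0 big_set1 npolypK ?size_poly1 // coef1 expr0 mul1r /sign_of eqxx.
by rewrite expr1n.
Qed.

Lemma card_self_recip_all0 : #|self_recip_all 0| = 1%N.
Proof. by rewrite self_recip_all0 cards1. Qed.

End Counts.

(** * Families of self-reciprocal polynomials subject to the determinant condition *)

Section Families.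
Variables (F : finFieldType) (n : nat).
Local Notation q := #|F|.
Local Notation U := {ffun 'I_n -> {poly_n.+1 F}}.
Implicit Types (u : U) (c : 'I_n -> nat).

(* For [d] the degree of [p], the determinant of a matrix with characteristic
   polynomial [p]. *)
Definition unit_sign d (p : {poly_n.+1 F}) : F := (-1) ^+ d * (p : {poly F})`_0.

Definition sign_family c := [set u : U | (u \in family (fun i => mem (self_recip_all F n (c i)))) &&
  (\prod_i unit_sign (c i) (u i) ^+ i.+1 == 1)].

Definition pm1 (x : F) := (x == 1) || (x == -1).

Lemma pm1M x y : pm1 x -> pm1 y -> pm1 (x * y).
Proof.
by case/orP=> /eqP-> /orP[] /eqP->; rewrite /pm1 ?mulN1r ?mul1r ?opprK eqxx ?orbT.
Qed.

Lemma pm1X x k : pm1 x -> pm1 (x ^+ k).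
Proof. by move=> x1; elim: k => [|k IH]; rewrite ?exprS ?pm1M // /pm1 eqxx. Qed.

Lemma pm1_sign d (p : {poly_n.+1 F}) : p \in self_recip_all F n d -> pm1 (unit_sign d p).
Proof.
rewrite inE => /andP[sp _]; apply: pm1M; last first.
  by have [->|->] := self_recip_coef0 sp; rewrite /pm1 eqxx ?orbT.
by apply: pm1X; rewrite /pm1 eqxx orbT.
Qed.

Section OddOrder.
Hypothesis oq : odd q.

Let n1 : (-1 == 1 :> F) = false.
Proof. by rewrite eq_sym; apply/negbTE; rewrite -odd_card_field. Qed.

Lemma sign_ofM x y : pm1 x -> pm1 y -> sign_of (x * y) = sign_of x * sign_of y.
Proof.
by case/orP=> /eqP-> /orP[] /eqP->; rewrite /sign_of
  ?mulN1r ?mul1r ?opprK ?n1 ?eqxx ?n1 ?mulN1r ?mul1r ?opprK.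
Qed.

Lemma sign_ofX x k : pm1 x -> sign_of (x ^+ k) = sign_of x ^+ k.
Proof.
move=> x1; elim: k => [|k IH]; first by rewrite !expr0 /sign_of eqxx.
by rewrite !exprS sign_ofM ?IH // pm1X.
Qed.

Lemma pm1_indicator x : pm1 x -> (x == 1)%:R = 2^-1 * (1 + sign_of x) :> rat.
Proof.
case/orP=> /eqP->; rewrite /sign_of ?eqxx ?n1; first by rewrite mulVf.
by rewrite subrr mulr0.
Qed.

(** The indicator of determinant 1 is the average of 1 and the sign of the determinant; both are
    products over the components, so their sums over all families factor. *)
Lemma card_sign_family_odd c : #|sign_family c|%:R =
  2^-1 * (\prod_i #|self_recip_all F n (c i)|%:R + \prod_i twist F n (c i) i.+1) :> rat.
Proof.
have -> : \prod_i #|self_recip_all F n (c i)|%:R =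
    \prod_i \sum_(p in self_recip_all F n (c i)) 1 :> rat.
  by apply: eq_bigr => i _; rewrite -sum1_card natr_sum.
rewrite /twist !bigA_distr_big_dep -big_split big_distrr /=.
rewrite -sum1_card natr_sum big_mkcond [RHS]big_mkcond /=; apply: eq_bigr => u _.
rewrite inE; case: (boolP (u \in family _)) => //= /familyP uc.
have s1 i : pm1 (unit_sign (c i) (u i) ^+ i.+1) by apply/pm1X/pm1_sign/uc.
have [p1 pE] : pm1 (\prod_i unit_sign (c i) (u i) ^+ i.+1) /\
    sign_of (\prod_i unit_sign (c i) (u i) ^+ i.+1) =
      \prod_i sign_of (unit_sign (c i) (u i)) ^+ i.+1.
  elim/big_ind2: _ => [|x y z t [x1 xE] [z1 zE]|i _]; first by rewrite /pm1 /sign_of eqxx.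
    by rewrite pm1M // sign_ofM // xE zE.
  by split=> //; rewrite sign_ofX // pm1_sign //; apply: uc.
rewrite big1_eq -[X in 1 + X]/(\prod_i sign_of (unit_sign (c i) (u i)) ^+ i.+1) -pE.
by rewrite -pm1_indicator //; case: (_ == 1).
Qed.

End OddOrder.

Lemma card_sign_family_even c : ~~ odd q ->
  #|sign_family c| = (\prod_i #|self_recip_all F n (c i)|)%N.
Proof.
move=> oq; have n1 : (-1 : F) = 1.
  by apply/esym/eqP; rewrite -[_ == _]negbK -odd_card_field.
have -> : (\prod_i #|self_recip_all F n (c i)| =
    #|family (fun i => mem (self_recip_all F n (c i)))|)%N.
  under eq_bigr do rewrite -sum1_card; rewrite bigA_distr_big_dep -[RHS]sum1_card.
  by apply: eq_bigr => u _; rewrite big1_eq.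
apply: eq_card => u; rewrite inE.
case: (boolP (u \in family _)) => //= /familyP uc; apply/eqP/big1 => i _.
have := pm1_sign (uc i); rewrite /pm1 n1 orbb => /eqP->; exact: expr1n.
Qed.

End Families.

Section Partitions.
Variables (F : finFieldType) (n : nat).
Local Notation q := #|F|.

Lemma partition_bound s x : is_partition n s -> x \in s -> (0 < x <= n)%N.
Proof.
case/and3P=> _ /allP s0 /eqP sn xs; have x0 : (0 < x)%N := s0 x xs; rewrite x0 -sn.
by rewrite sumnE (big_rem _ xs) leq_addr.
Qed.

Lemma mult_bound s x : is_partition n s -> x \in s -> (0 < mult s x <= n)%N.
Proof.
move=> sp xs; rewrite -has_count has_pred1 xs /=.
have [_ s0 /eqP <-] := and3P sp; rewrite (leq_trans (count_size _ _)) //.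
by elim: s s0 {sp xs} => //= y s IH /andP[y0 /IH sz]; rewrite -add1n leq_add.
Qed.

Lemma prod_undup (R : comNzRingType) s (E : nat -> R) : is_partition n s ->
  \prod_(i < n) (if i.+1 \in s then E i.+1 else 1) = \prod_(i <- undup s) E i.
Proof.
move=> sp; rewrite -(big_mkord xpredT (fun i => if i.+1 \in s then E i.+1 else 1)).
rewrite -big_mkcond -(big_map S (mem s) E) -big_filter; apply: perm_big.
apply: uniq_perm; rewrite ?undup_uniq ?filter_uniq ?(map_inj_uniq succn_inj) ?iota_uniq //.
move=> x; rewrite mem_undup mem_filter.
case: (boolP (x \in s)) => xs; rewrite /= ?(negPf xs) //; move: (xs) => ->.
have /andP[x0 xn] := partition_bound sp xs; apply/mapP.
by exists x.-1; rewrite ?prednK // mem_index_iota /= prednK.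
Qed.

(** For odd [q], compare the product of the counts with the product of the twists. If all parts are
    even, they agree. If some [i n_i] is odd, a twist vanishes and half the counts remain. Otherwise
    an odd part contributes [q + 1] to the first product and [q - 1] to the second, times a common
    power of [q], and the average produces [fnu]. *)
Lemma slnuE s : is_partition n s ->
  slnu q s = #|sign_family F (fun i : 'I_n => mult s i.+1)|%:R.
Proof.
move=> sp.
have notin i : i \notin s -> mult s i = 0%N by move/count_memPn.
have TE : \prod_(i < n) #|self_recip_all F n (mult s i.+1)|%:R =
    \prod_(i <- undup s) (nqd q (mult s i))%:R :> rat.
  rewrite -(prod_undup (fun i => (nqd q (mult s i))%:R)) //; apply: eq_bigr => i _.
  case: (boolP (i.+1 \in s)) => [xs|xs]; last by rewrite notin // card_self_recip_all0.
  by rewrite card_self_recip_all // mult_bound.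
rewrite /slnu; case: (boolP (odd q)) => oq /=; last first.
  by rewrite card_sign_family_even // natr_prod TE.
have WE : \prod_(i < n) twist F n (mult s i.+1) i.+1 = \prod_(i <- undup s)
   if odd i then (if odd (mult s i) then 0 else (q.-1 * q ^ (mult s i)./2.-1)%:R)
   else (nqd q (mult s i))%:R.
  rewrite -(prod_undup (fun i => if odd i then if odd (mult s i) then 0 else
    (q.-1 * q ^ (mult s i)./2.-1)%:R else (nqd q (mult s i))%:R)) //.
  apply: eq_bigr => i _.
  case: (boolP (i.+1 \in s)) => [xs|xs]; last by rewrite notin // twist0.
  by rewrite twistE // mult_bound.
rewrite card_sign_family_odd // TE WE; case: ifPn => [/allP ev|_].
  have evE : \prod_(i <- undup s) (nqd q (mult s i))%:R = \prod_(i <- undup s)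
      (if odd i then if odd (mult s i) then 0 else (q.-1 * q ^ (mult s i)./2.-1)%:R
       else (nqd q (mult s i))%:R) :> rat.
    rewrite big_seq [RHS]big_seq; apply: eq_bigr => i; rewrite mem_undup.
    by move/ev/negPf->.
  by rewrite -evE -mulr2n -[X in _ = _ * X]mulr_natl mulKf.
case: ifPn => [/hasP[i xs]|/hasPn no].
  rewrite oddM => /andP[oi om]; congr (_ * _).
  have ixs : i \in undup s by rewrite mem_undup.
  by rewrite [X in _ = _ + X](big_rem i) //= oi om mul0r addr0.
have mE i : i \in undup s -> odd i -> odd (mult s i) = false.
  by rewrite mem_undup => /no; rewrite oddM negb_and => /orP[/negPf->//|/negPf].
pose X := \prod_(i <- undup s | odd i) (q ^ (mult s i)./2.-1)%:R : rat.
pose Y := \prod_(i <- undup s | ~~ odd i) (nqd q (mult s i))%:R : rat.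
have constE m : (m ^ count odd (undup s))%:R = \prod_(i <- undup s | odd i) m%:R :> rat.
  by rewrite big_const_seq iter_mulr_1 natrX.
have split_odd (G : nat -> rat) m :
    (forall i, odd i -> odd (mult s i) = false -> G i = m%:R * (q ^ (mult s i)./2.-1)%:R) ->
    (forall i, ~~ odd i -> G i = (nqd q (mult s i))%:R) ->
    \prod_(i <- undup s) G i = (m ^ count odd (undup s))%:R * X * Y.
  move=> Go Ge; rewrite (bigID odd) /=; congr (_ * _); last by apply: eq_bigr.
  rewrite constE -big_split /= big_seq_cond [RHS]big_seq_cond.
  by apply: eq_bigr => i /andP[iu oi]; rewrite Go ?mE.
rewrite (split_odd _ q.+1); first 1 last.
- by move=> i oi om; rewrite /nqd oq om natrM.
- by [].
rewrite (split_odd _ q.-1); first 1 last.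
- by move=> i oi om; rewrite oi om natrM.
- by move=> i /negPf->.
by rewrite /fnu -/X -/Y natrD -!mulrDl [_ / 2]mulrC !mulrA.
Qed.

End Partitions.

(** * Types of conjugacy classes *)

Section Types.
Variable n : nat.
Implicit Types (c : 'I_n -> nat) (s : seq nat).

Definition part_blocks c := flatten [seq nseq (c i) i.+1 | i <- enum 'I_n].

Definition part_of c := sort geq (part_blocks c).

Lemma perm_part_of c : perm_eq (part_of c) (part_blocks c).
Proof. by rewrite perm_sort. Qed.

Lemma count_part_of c x : count_mem x (part_of c) = (\sum_(i < n) (i.+1 == x) * c i)%N.
Proof.
rewrite (seq.permP (perm_part_of c)) count_flatten -map_comp sumnE big_map big_enum /=.
by apply: eq_bigr => i _; rewrite count_nseq.
Qed.

Lemma mult_part_of c (i : 'I_n) : mult (part_of c) i.+1 = c i.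
Proof.
rewrite /mult count_part_of (bigD1 i) //= eqxx mul1n big1 ?addn0 // => j ji.
by rewrite eqSS (negPf (ji : (j : nat) != i)).
Qed.

Lemma sumn_part_of c : sumn (part_of c) = (\sum_(i < n) i.+1 * c i)%N.
Proof.
rewrite sumnE (perm_big _ (perm_part_of c)) /= big_flatten big_map big_enum /=.
by apply: eq_bigr => i _; rewrite big_nseq iter_addn_0 mulnC.
Qed.

Lemma mem_part_of c x : x \in part_of c -> (0 < x <= n)%N.
Proof.
rewrite (perm_mem (perm_part_of c)) => /flattenP[t /mapP[i _ ->]].
by rewrite mem_nseq => /andP[_ /eqP->]; rewrite ltn_ord.
Qed.

Lemma part_of_partition c : (\sum_(i < n) i.+1 * c i)%N = n -> is_partition n (part_of c).
Proof.
move=> cn; apply/and3P; split; last by rewrite sumn_part_of cn.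
  by apply: sort_sorted => x y; apply: leq_total.
by apply/allP => x /mem_part_of /andP[].
Qed.

Lemma partitionE s : is_partition n s -> part_of (fun i => mult s i.+1) = s.
Proof.
move=> sp; apply: (@sorted_eq _ geq).
- by move=> x y z yx xz; apply: leq_trans xz yx.
- by move=> x y; rewrite andbC => /anti_leq.
- by apply: sort_sorted => x y; apply: leq_total.
- by case/and3P: sp.
apply/allP => x; rewrite mem_cat => xs /=; apply/eqP.
have /andP[x0 xn] : (0 < x <= n)%N.
  by case/orP: xs => [/mem_part_of//|/(partition_bound sp)].
have x1n : (x.-1 < n)%N by rewrite prednK.
by have := mult_part_of (fun i => mult s i.+1) (Ordinal x1n); rewrite /= prednK.
Qed.

Lemma sumn_mult s : is_partition n s -> (\sum_(i < n) i.+1 * mult s i.+1)%N = n.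
Proof. by move=> sp; rewrite -sumn_part_of partitionE //; case/and3P: sp => _ _ /eqP. Qed.

End Types.

Section SumOverTypes.
Variables (F : finFieldType) (n : nat).
Local Notation q := #|F|.
Local Notation U := {ffun 'I_n -> {poly_n.+1 F}}.
Implicit Types (u : U).

Definition degs u (i : 'I_n) := deg (u i : {poly F}).

Definition type_part u := part_of (degs u).

(** The values taken by the invariant [type_vec] on [realset], by [realsetE] and
    [exists_type_vec]. *)
Definition good := [set u : U | [&& [forall i, self_recip (u i : {poly F})],
  (\sum_(i < n) i.+1 * degs u i == n)%N & \prod_(i < n) unit_sign (degs u i) (u i) ^+ i.+1 == 1]].

Lemma self_recip_size (p : {poly F}) : self_recip p -> size p = (deg p).+1.
Proof. by case/and3P => /monic_neq0 p0 _ _; rewrite prednK // size_poly_gt0. Qed.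

Lemma good_type_part (nu : n.-bseq 'I_n.+1) : is_partition n (parts nu) ->
  [set u in good | parts nu == type_part u] = sign_family F (fun i : 'I_n => mult (parts nu) i.+1).
Proof.
move=> nup; apply/setP => u; rewrite !inE; apply/idP/idP.
  move=> /andP[/and3P[/forallP us _ sgn] /eqP nuE].
  have dE (i : 'I_n) : mult (parts nu) i.+1 = degs u i by rewrite nuE mult_part_of.
  apply/andP; split; last by under eq_bigr do rewrite dE.
  by apply/familyP => i; rewrite inE us dE /= {1}self_recip_size.
move=> /andP[/familyP uf sgn].
have ui (i : 'I_n) : self_recip (u i : {poly F}) /\ degs u i = mult (parts nu) i.+1.
  by have := uf i; rewrite inE => /andP[-> /eqP sz]; rewrite /degs sz.
have -> : parts nu == type_part u.
  rewrite -{1}(partitionE nup); apply/eqP; rewrite /type_part /part_of /part_blocks; congr sort.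
  by congr flatten; apply: eq_map => i; have [_ ->] := ui i.
rewrite andbT; apply/and3P; split.
- by apply/forallP => i; case: (ui i).
- apply/eqP; rewrite -[RHS](sumn_mult nup); apply: eq_bigr => i _.
  by have [_ ->] := ui i.
by under eq_bigr => i _ do have [_ ->] := ui i.
Qed.

Lemma sum_good : (\sum_(u in good) hnu q (type_part u))%:R =
  \sum_(nu : n.-bseq 'I_n.+1 | is_partition n (parts nu))
     (hnu q (parts nu))%:R * slnu q (parts nu) :> rat.
Proof.
transitivity ((\sum_(u in good) \sum_(nu : n.-bseq 'I_n.+1 |
    is_partition n (parts nu) && (parts nu == type_part u)) hnu q (parts nu))%:R : rat).
  congr (_%:R); apply: eq_bigr => u; rewrite inE => /and3P[_ /eqP un _].
  have tp : is_partition n (type_part u) by apply: part_of_partition.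
  have [nu0 nu0E] := partition_partsP tp.
  rewrite (big_pred1 nu0) ?nu0E // => nu /=.
  apply/andP/eqP => [[_ /eqP E]|->]; first by apply: parts_inj; rewrite nu0E.
  by rewrite nu0E.
rewrite (exchange_big_dep (fun nu : n.-bseq 'I_n.+1 => is_partition n (parts nu))) /=; last first.
  by move=> u nu _ /andP[].
rewrite natr_sum; apply: eq_bigr => nu nup; rewrite (slnuE F nup) -good_type_part //.
rewrite sum_nat_cond_const -natrM mulnC; congr ((_ * _)%:R).
by apply: eq_card => u; rewrite !inE nup.
Qed.

End SumOverTypes.

(** * Conjugacy classes of the general and special linear groups *)

Section ClassCount.
Variables (gT : finGroupType) (G : {group gT}).

(** A class [C] inside [X] contributes [#|C|] terms equal to the inverse of [#|C|]. *)
Lemma card_classes_sub (X : {set gT}) : X \subset G ->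
  (forall x y, x \in X -> y \in G -> (x ^ y)%g \in X) ->
  #|[set C in classes G | C \subset X]|%:R = \sum_(g in X) #|g ^: G|%g%:R^-1 :> rat.
Proof.
move=> XG XJ.
rewrite (partition_big (fun g => (g ^: G)%g) (mem [set C in classes G | C \subset X])) /=.
  rewrite -sum1_card natr_sum; apply: eq_bigr => C; rewrite inE => /andP[/imsetP[x xG CE] CX].
  have -> : \sum_(g in X | (g ^: G)%g == C) #|g ^: G|%g%:R^-1 = \sum_(g in C) #|C|%:R^-1 :> rat.
    apply: eq_big => [g|g /andP[_ /eqP->] //].
    apply/andP/idP => [[gX /eqP <-]|gC]; first exact: class_refl.
    by split; [apply: (subsetP CX) | apply/eqP; move: gC; rewrite CE => /class_eqP].
  rewrite sumr_const -[RHS]mulr_natl mulfV // pnatr_eq0 -lt0n.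
  by apply/card_gt0P; exists x; rewrite CE class_refl.
move=> g gX; rewrite inE mem_classes ?(subsetP XG) //=.
by apply/subsetP => _ /imsetP[y yG ->]; apply: XJ.
Qed.

End ClassCount.

Section GL.
Variables (F : finFieldType) (m : nat).
Local Notation n := m.+1.
Local Notation q := #|F|.
Local Notation gT := {'GL_m.+1[F]}.
Implicit Types (g h : gT).

Definition mkGL (A : 'M[F]_n) (Au : A \in unitmx) : gT := FinRing.unit _ Au.

Lemma mkGLE A Au : GLval (@mkGL A Au) = A. Proof. by []. Qed.

Lemma GL_inj : injective (@GLval n F). Proof. exact: val_inj. Qed.

Lemma conj_simP g g' : reflect (sim (GLval g) (GLval g')) (g' \in g ^: [set: gT])%g.
Proof.
apply: (iffP imsetP) => [[h _ ->]|/sim_unit[P Pu PE]].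
  apply: (@unit_sim _ _ _ _ (GLval h)); first exact: GL_unitmx.
  by rewrite -!GL_MxE conjgE !mulgA mulgV mul1g.
exists (mkGL Pu); first by rewrite inE.
apply: GL_inj; rewrite conjgE !GL_MxE GL_VxE mkGLE mulmxA -[LHS](mulKmx Pu) PE.
by rewrite !mulmxA.
Qed.

Lemma GL_det_neq0 g : \det (GLval g) != 0.
Proof. by rewrite -unitfE -unitmxE GL_unitmx. Qed.

Definition gldet g : {unit F} := FinRing.unit F (etrans (unitfE _) (GL_det_neq0 g)).

Lemma gldetM : {in [set: gT] &, {morph gldet : x y / (x * y)%g}}.
Proof. by move=> x y _ _; apply: val_inj; exact: det_mulmx. Qed.

Canonical gldet_morphism := Morphism gldetM.

Lemma ker_gldet : ('ker gldet)%g = SL n F.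
Proof. by apply/setP => x; rewrite !inE /= -val_eqE. Qed.

Lemma gldet_surj : (gldet @* [set: gT])%g = [set: {unit F}].
Proof.
apply/eqP; rewrite -subTset; apply/subsetP => x _.
pose A : 'M[F]_n := diag_mx (\row_j if j == 0 then FinRing.uval x else 1).
have dA : \det A = FinRing.uval x.
  rewrite det_diag (bigD1 0) //= mxE eqxx big1 ?mulr1 // => j j0.
  by rewrite mxE (negPf j0).
have Au : A \in unitmx by rewrite unitmxE dA (valP x).
apply/morphimP; exists (mkGL Au); rewrite ?inE //.
by apply: val_inj; exact: (esym dA).
Qed.

(** Orbit-stabilizer in both groups, combined with the fact that the centralizer in SL_n is the
    kernel of the determinant on the centralizer in GL_n. *)
Lemma card_conj_class g :
  (#|(g ^: [set: gT])%g| * #|(gldet @* 'C[g])%g| = q.-1 * #|(g ^: SL n F)%g|)%N.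
Proof.
have Cg : (#|('C[g])%g| * #|(g ^: [set: gT])%g| = #|[set: gT]|)%N.
  by rewrite -index_cent1 -[RHS](LagrangeI _ 'C[g]%g) indexgI setTI.
have CS : (#|('C_(SL n F)[g])%g| * #|(g ^: SL n F)%g| = #|SL n F|)%N.
  by rewrite -index_cent1 -[RHS](LagrangeI _ 'C[g]%g) indexgI.
have Sq : (#|SL n F| * q.-1 = #|[set: gT]|)%N.
  rewrite -card_finField_unit -gldet_surj card_morphim setTI ker_gldet.
  by rewrite -[RHS](LagrangeI _ (SL n F)) setTI.
have DC : (#|('C_(SL n F)[g])%g| * #|(gldet @* 'C[g])%g| = #|('C[g])%g|)%N.
  by rewrite card_morphim setTI ker_gldet -[RHS](LagrangeI _ (SL n F)) setIC.
have C0 : (0 < #|('C_(SL n F)[g])%g|)%N := cardG_gt0 _.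
apply/eqP; rewrite -(eqn_pmul2l C0); apply/eqP.
transitivity #|[set: gT]|; first by rewrite -Cg -DC mulnAC mulnA.
by rewrite -Sq -CS mulnAC mulnA.
Qed.

Definition type_vec g : {ffun 'I_n -> {poly_n.+1 F}} :=
  [ffun i => npolyp n.+1 (type_poly (GLval g) (i : 'I_n).+1)].

Lemma type_vecE g i : type_vec g i = type_poly (GLval g) i.+1 :> {poly F}.
Proof. by rewrite ffunE npolypK // type_poly_size. Qed.

Lemma type_vec_conj g g' : (type_vec g == type_vec g') = (g' \in g ^: [set: gT])%g.
Proof.
apply/eqP/conj_simP => [E|sgg'].
  by apply/type_poly_sim => i; rewrite -!type_vecE E.
by apply/ffunP => i; apply: val_inj; rewrite /= !type_vecE; move/type_poly_sim: sgg'.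
Qed.

Lemma mem_type_part g i : (0 < i)%N ->
  (i \in type_part (type_vec g)) = (type_poly (GLval g) i != 1).
Proof.
move=> i0; case: (leqP i n) => ni.
  have i1n : (i.-1 < n)%N by rewrite prednK.
  have := mult_part_of (degs (type_vec g)) (Ordinal i1n); rewrite /= prednK // => E.
  rewrite -has_pred1 has_count -/(mult _ _) E /degs type_vecE /= prednK //.
  have mon := type_poly_monic (GLval g) i0; set p := type_poly _ _ in mon *.
  apply/idP/idP; first by apply: contraTneq => ->; rewrite size_poly1.
  rewrite lt0n; apply: contra => p1; move: mon; rewrite (@size1_polyC _ p).
    by rewrite monicE lead_coefC => /eqP->.
  by move: p1; case: size => [|[]].
apply/idP/idP => [/mem_part_of /andP[_]|]; first by rewrite leqNgt ni.
have [l Al] := primary_exist (GLval g).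
rewrite (type_polyE Al i0) => /(mult_poly_neq1 Al.1)[f _ fl].
by have [/andP[_ /=]] := primary_bound Al fl; rewrite leqNgt ni.
Qed.

Lemma hnu_dvd a s x : x \in a :: s -> (hnu a.+1 s %| x)%N.
Proof.
rewrite inE => /predU1P[->|]; rewrite /hnu /=.
  by elim: s => //= y s IH; apply: dvdn_trans (dvdn_gcdr _ _) IH.
elim: s => //= y s IH; rewrite inE => /predU1P[->|/IH]; first exact: dvdn_gcdl.
exact/dvdn_trans/dvdn_gcdr.
Qed.

Lemma mem_exp_gcd (rT : finGroupType) (D : {group rT}) w a b :
  (w ^+ a \in D -> w ^+ b \in D -> w ^+ gcdn a b \in D)%g.
Proof.
case: a => [|a] wa wb; first by rewrite gcd0n.
(* Bezout in the form [gcd + c b = k (a + 1)], which needs no negative exponents. *)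
have [c _ /dvdnP[k E]] := Bezoutl b (ltn0Sn a).
have : (w ^+ (gcdn a.+1 b + c * b) \in D)%g by rewrite E mulnC expgM groupX.
by rewrite expgD groupMr // mulnC expgM groupX.
Qed.

(** The determinants of the centralizer are exactly the [h]-th powers: all are such powers by
    [centralizer_det_le], while [centralizer_det_ge] supplies the [i]-th powers for every part [i],
    whose exponents together with [q - 1] have gcd [h]. *)
Lemma card_cent_det g : (#|(gldet @* 'C[g])%g| * hnu q (type_part (type_vec g)) = q.-1)%N.
Proof.
set h := hnu q _; set D := (gldet @* 'C[g])%g.
have q1 : (1 < q)%N := finNzRing_gt1 F.
have [w wE] : exists w : {unit F}, [set: {unit F}] = <[w]>%g.
  exact/cyclicP/field_unit_group_cyclic.
have ow : #[w]%g = q.-1 by rewrite /order -wE card_finField_unit.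
have hq x : x \in q.-1 :: type_part (type_vec g) -> (h %| x)%N.
  by move=> xs; rewrite /h -(prednK (ltnW q1)); apply: hnu_dvd.
have h0 : (0 < h)%N.
  by have := hq q.-1 (mem_head _ _); apply: dvdn_gt0; rewrite -ltnS prednK // ltnW.
have memD c : c *m GLval g = GLval g *m c ->
    forall x : {unit F}, \det c = FinRing.uval x -> x \in D.
  move=> cg x dx; have cu : c \in unitmx by rewrite unitmxE dx (valP x).
  apply/morphimP; exists (mkGL cu); first by rewrite inE.
    by apply/cent1P; apply: GL_inj; rewrite !GL_MxE mkGLE cg.
  by apply: val_inj; exact: (esym dx).
have DE : D = <[w ^+ h]>%g.
  apply/eqP; rewrite eqEsubset; apply/andP; split; apply/subsetP => x.
    move=> /morphimP[c _ /cent1P cg ->] /=.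
    have [y yE] : exists y, \det (GLval c) = y ^+ h.
      apply: (@centralizer_det_le _ _ (GLval g)) => //.
        by move=> i i0 ui; apply: hq; rewrite inE mem_type_part // ui orbT.
      by rewrite -!GL_MxE cg.
    have y0 : y != 0.
      by apply: contraTneq (GL_det_neq0 c) => y0; rewrite yE y0 expr0n eqn0Ngt h0 negbK.
    rewrite (_ : gldet c = (FinRing.unit F (etrans (unitfE _) y0) ^+ h)%g); last first.
      by apply: val_inj; rewrite /= FinRing.val_unitX /= -yE.
    have : FinRing.unit F (etrans (unitfE _) y0) \in <[w]>%g by rewrite -wE inE.
    by move=> /cycleP[k ->]; rewrite -expgM mulnC expgM mem_cycle.
  move=> /cycleP[k ->]; apply: groupX.
  have wi i : (0 < i)%N -> i \in type_part (type_vec g) -> (w ^+ i)%g \in D.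
    move=> i0; rewrite mem_type_part // => ui.
    have w0 : FinRing.uval w != 0 by rewrite -unitfE (valP w).
    have [c cg dc] := centralizer_det_ge i0 ui w0.
    by apply: memD cg _ _; rewrite dc FinRing.val_unitX.
  have t0 i : i \in type_part (type_vec g) -> (0 < i)%N by move/mem_part_of => /andP[].
  rewrite /h /hnu; elim: (type_part (type_vec g)) t0 wi {h hq h0} => [_ _|i s IH t0 wi] /=.
    by rewrite -ow expg_order group1.
  apply: mem_exp_gcd; first by rewrite wi ?t0 ?mem_head.
  by apply: IH => [j js|j j0 js]; [apply: t0|apply: wi]; rewrite // inE js orbT.
rewrite DE -orderE orderXdiv ow ?divnK // hq ?mem_head //.
Qed.

(** Since [type_vec] is constant on a class of GL_n, the class splits into [hnu] classes of SL_n of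
    equal size. *)
Lemma card_conj_class_ratio g :
  (#|(g ^: [set: gT])%g| = hnu q (type_part (type_vec g)) * #|(g ^: SL n F)%g|)%N.
Proof.
have D0 : (0 < #|(gldet @* 'C[g])%g|)%N := cardG_gt0 _.
apply/eqP; rewrite -(eqn_pmul2r D0) card_conj_class -(card_cent_det g); apply/eqP.
by rewrite mulnC mulnA mulnAC -!mulnA [RHS]mulnC mulnA mulnAC.
Qed.

End GL.

(** * Real and strongly real classes of SL_n *)

Section Reality.
Variables (F : finFieldType) (m : nat).
Local Notation n := m.+1.
Local Notation q := #|F|.
Local Notation gT := {'GL_m.+1[F]}.
Implicit Types (g h : gT).

(* The elements of SL_n that are real in GL_n. *)
Definition realset : {set gT} := [set g in SL n F | (g^-1 \in g ^: [set: gT])%g].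

(** The constant term of the characteristic polynomial is [(-1)^n] times the determinant, and the
    signs inside the [unit_sign] factors also multiply to [(-1)^n]. *)
Lemma det_type_vec g :
  \det (GLval g) = \prod_(i < n) unit_sign (degs (type_vec g) i) (type_vec g i) ^+ i.+1.
Proof.
have E : (-1) ^+ n * \det (GLval g) = \prod_(i < n) (type_poly (GLval g) i.+1)`_0 ^+ i.+1.
  rewrite -char_poly_det type_poly_char -horner_coef0 horner_prod; apply: eq_bigr => i _.
  by rewrite horner_exp horner_coef0.
rewrite (eq_bigr (fun i : 'I_n => (-1) ^+ (i.+1 * deg (type_poly (GLval g) i.+1)) *
   (type_poly (GLval g) i.+1)`_0 ^+ i.+1)); last first.
  by move=> i _; rewrite /unit_sign /degs type_vecE exprMn -exprM mulnC.
rewrite big_split /= -E -expr_sum type_poly_dim.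
by rewrite mulrA -exprD addnn -mul2n exprM sqrrN !expr1n mul1r.
Qed.

Lemma realsetE g : (g \in realset) = (type_vec g \in good F n).
Proof.
rewrite !inE det_type_vec andbC -type_vec_conj; set d := _ == 1.
have -> : (\sum_(i < n) i.+1 * degs (type_vec g) i == n)%N.
  rewrite -[X in _ == X](type_poly_dim (GLval g)).
  by apply/eqP/eq_bigr => i _; rewrite /degs type_vecE.
rewrite /=; congr (_ && _); apply/eqP/forallP => [E i|E].
  rewrite /self_recip type_vecE type_poly_monic // type_poly_coef0 ?GL_unitmx //=.
  have := type_vecE g^-1%g i; rewrite -E type_vecE GL_VxE type_poly_inv ?GL_unitmx // => uE.
  by rewrite -uE.
apply/ffunP => i; apply: val_inj; rewrite /= !type_vecE GL_VxE type_poly_inv ?GL_unitmx //.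
by have /and3P[_ _ /eqP] := E i; rewrite type_vecE.
Qed.

Lemma exists_type_vec u : u \in good F n -> exists g, type_vec g = u.
Proof.
rewrite inE => /and3P[/forallP us /eqP un _].
(* [v] shifts the index of [u] by one and takes the value 1 beyond [n]. *)
pose v k : {poly F} := if insub k.-1 is Some i then u (i : 'I_n) else 1.
have vE (i : 'I_n) : v i.+1 = u i by rewrite /v /= valK.
have vm k : v k \is monic.
  by rewrite /v; case: insub => [i|]; [have /and3P[] := us i | apply: monic1].
have vn : (\sum_(i < n) i.+1 * deg (v i.+1))%N = n.
  by rewrite -[RHS]un; apply: eq_bigr => i _; rewrite vE.
have [A AE] := exists_type_poly vm vn.
have Au : A \in unitmx.
  rewrite -char_coef0 type_poly_char -horner_coef0 horner_prod; apply/prodf_neq0 => i _.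
  by rewrite horner_exp expf_neq0 // horner_coef0 AE vE; have /and3P[] := us i.
exists (mkGL Au); apply/ffunP => i; apply: val_inj.
by rewrite /= type_vecE mkGLE AE vE.
Qed.

(** Here 4 divides [q - 1], and a generator of the multiplicative group raised to the power
    [(q - 1)/4] has square -1. *)
Lemma sqrt_neg1 : odd q -> (q %% 4 <> 3)%N -> exists x : F, x ^+ 2 = -1.
Proof.
move=> oq q4; have q1 : (1 < q)%N := finNzRing_gt1 F.
have [w wE] : exists w : {unit F}, [set: {unit F}] = <[w]>%g.
  exact/cyclicP/field_unit_group_cyclic.
have ow : #[w]%g = q.-1 by rewrite /order -wE card_finField_unit.
have [k kE] : exists k, q.-1 = (4 * k)%N.
  by exists (q.-1 %/ 4)%N; move: (#|F|) oq q4 q1 => x; lia.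
exists (FinRing.uval (w ^+ k)%g).
have : FinRing.uval (w ^+ (2 * k))%g != 1.
  rewrite -FinRing.val_unit1 (inj_eq val_inj) -order_dvdn ow kE.
  by apply/negP => /dvdn_leq; move: kE q1; move: (#|F|) => x; lia.
have : FinRing.uval (w ^+ (2 * k))%g ^+ 2 = 1.
  by rewrite -FinRing.val_unitX -expgM mulnAC -kE -ow expg_order.
move/eqP; rewrite sqrf_eq1 => /orP[->//|/eqP E _].
by rewrite -FinRing.val_unitX -expgM mulnC; exact: E.
Qed.

Lemma realset_reverser g : g \in realset ->
  reverser (GLval g) 1 \/
  ((n %% 4 = 2)%N /\ reverser (GLval g) (-1)).
Proof.
rewrite inE => /andP[_ /conj_simP]; rewrite GL_VxE => sign_of.
case: (exists_reverser (GL_unitmx g) sign_of) => [[]|[ne R]]; first by left.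
move: R; rewrite -signr_odd; case: (boolP (odd _)) => on R; last by left.
by right; split=> //; move: on ne => /=; lia.
Qed.

Lemma reverser_strong g : reverser (GLval g) 1 -> strongly_real_elt (SL n F) g.
Proof.
move=> [h [hh hg dh]]; have hu : h \in unitmx by rewrite unitmxE dh unitr1.
apply/existsP; exists (mkGL hu); apply/and3P; split.
- by rewrite inE mkGLE dh.
- by apply/eqP/GL_inj; rewrite expgS expg1 GL_MxE mkGLE hh.
have -> : (mkGL hu * g)%g = (g^-1 * mkGL hu)%g by apply: GL_inj; rewrite !GL_MxE GL_VxE.
by rewrite mulgK.
Qed.

Lemma realset_strong g : (n %% 4 <> 2)%N \/ ~~ odd q -> g \in realset ->
  strongly_real_elt (SL n F) g.
Proof.
move=> hn /realset_reverser[|[n4 R]]; first exact: reverser_strong.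
case: hn => // oq; apply: reverser_strong; move: R.
by have /negPn/eqP <- : ~~ ((1 : F) != -1) by rewrite -odd_card_field.
Qed.

(** As 4 does not divide [n], some part [i] is not divisible by 4. Then -1 is an [i]-th power: of -1
    itself if [i] is odd, of a square root of -1 if [i] is 2 modulo 4. *)
Lemma centralizer_det_neg1 g : (n %% 4 = 2)%N -> odd q -> (q %% 4 <> 3)%N ->
  exists2 c, c *m GLval g = GLval g *m c & \det c = -1.
Proof.
move=> n4 oq q4.
have [i i4 ui] : exists2 i : 'I_n, (i.+1 %% 4 <> 0)%N & type_poly (GLval g) i.+1 != 1.
  have [/existsP[i /andP[/eqP i4 ui]]|no] :=
    boolP [exists i : 'I_n, (i.+1 %% 4 != 0)%N && (type_poly (GLval g) i.+1 != 1)].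
    by exists i.
  have n40 : (4 %| n)%N.
    rewrite -[X in (_ %| X)%N](type_poly_dim (GLval g)); apply: dvdn_sum => i _.
    move: no; rewrite negb_exists => /forallP/(_ i); rewrite negb_and !negbK.
    case/orP => [i4|/eqP->]; first by rewrite dvdn_mulr.
    by rewrite size_poly1 muln0.
  by move: n40; rewrite /dvdn n4.
have [x x2] := sqrt_neg1 oq q4.
have x0 : x != 0 by apply: contra_eq_neq x2 => ->; rewrite expr0n eq_sym oppr_eq0 oner_eq0.
case: (boolP (odd i.+1)) => oi.
  have [|c cg dc] := centralizer_det_ge (x := -1) (ltn0Sn i) ui; first by rewrite oppr_eq0 oner_eq0.
  by exists c => //; rewrite dc -signr_odd oi.
have [c cg dc] := centralizer_det_ge (ltn0Sn i) ui x0; exists c => //.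
have iE : i.+1 = (2 * i.+1./2)%N by rewrite mul2n -[LHS]odd_double_half (negPf oi).
rewrite dc iE exprM x2 -signr_odd.
have -> : odd i.+1./2 by move: i4 iE; move: (i.+1./2) => k; lia.
by [].
Qed.

(** When only a reversing involution of determinant -1 is at hand, its product with a commuting
    matrix of determinant -1 still inverts [g] and lies in SL_n. *)
Lemma realset_real g : (n %% 4 <> 2)%N \/ (q %% 4 <> 3)%N -> g \in realset ->
  real_elt (SL n F) g.
Proof.
have strong_real : strongly_real_elt (SL n F) g -> real_elt (SL n F) g.
  by case/existsP => h /and3P[hS _ hg]; apply/existsP; exists h; rewrite hS.
move=> hn gX; have [oq|oq] := boolP (odd q); last first.
  by apply/strong_real/realset_strong => //; right.
case: (realset_reverser gX) => [R|[n4 [h [hh hg dh]]]].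
  exact/strong_real/reverser_strong.
case: hn => // q4; have [c cg dc] := centralizer_det_neg1 g n4 oq q4.
have hcd : \det (h *m c) = 1 by rewrite det_mulmx dh dc mulrNN mulr1.
have hcu : h *m c \in unitmx by rewrite unitmxE hcd unitr1.
apply/existsP; exists (mkGL hcu); rewrite inE mkGLE hcd eqxx /=.
have -> : (mkGL hcu * g)%g = (g^-1 * mkGL hcu)%g; last by rewrite mulgK.
by apply: GL_inj; rewrite !GL_MxE GL_VxE mkGLE -mulmxA cg !mulmxA hg.
Qed.

Lemma real_sub g : g \in SL n F -> real_elt (SL n F) g -> g \in realset.
Proof.
move=> gS /existsP[h /andP[hS /eqP hg]]; rewrite inE gS; apply/imsetP.
by exists h^-1%g; [rewrite inE | rewrite conjgE invgK -hg mulgA].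
Qed.

Lemma strong_sub g : strongly_real_elt (SL n F) g -> real_elt (SL n F) g.
Proof. by case/existsP => h /and3P[hS _ hg]; apply/existsP; exists h; rewrite hS. Qed.

Lemma realsetJ g h : g \in realset -> (g ^ h)%g \in realset.
Proof.
rewrite !realsetE; suff -> : type_vec (g ^ h)%g = type_vec g by [].
by apply/esym/eqP; rewrite type_vec_conj; apply/imsetP; exists h; first by rewrite inE.
Qed.

Lemma class_subset_realset C : C \in classes (SL n F) ->
  (forall g, g \in C -> g \in SL n F) .
Proof. by move=> /imsetP[x xS ->] g /imsetP[y yS ->]; rewrite groupJ. Qed.

Lemma real_classesE : (n %% 4 <> 2)%N \/ (q %% 4 <> 3)%N ->
  real_classes (SL n F) = [set C in classes (SL n F) | C \subset realset].
Proof.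
move=> hn; apply/setP => C; rewrite !inE; apply: andb_id2l => CS.
apply/forall_inP/subsetP => H g gC; last exact/realset_real/H.
by apply: real_sub (H g gC); apply: class_subset_realset CS g gC.
Qed.

Lemma strongly_real_classesE : (n %% 4 <> 2)%N \/ ~~ odd q ->
  strongly_real_classes (SL n F) = [set C in classes (SL n F) | C \subset realset].
Proof.
move=> hn; apply/setP => C; rewrite !inE; apply: andb_id2l => CS.
apply/forall_inP/subsetP => H g gC; last exact/realset_strong/H.
by apply: real_sub (strong_sub (H g gC)); apply: class_subset_realset CS g gC.
Qed.

(** A class of GL_n is [hnu] times as large as the classes of SL_n inside it, so the inverse sizes
    of the latter, summed over its elements, give [hnu]. *)
Lemma sum_realset : \sum_(g in realset) #|(g ^: SL n F)%g|%:R^-1 =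
  (\sum_(u in good F n) hnu q (type_part u))%:R :> rat.
Proof.
rewrite (partition_big (@type_vec F m) (mem (good F n))) /=; last by move=> g; rewrite realsetE.
rewrite natr_sum; apply: eq_bigr => u ug; have [g0 g0u] := exists_type_vec ug.
have K0 : (0 < #|(g0 ^: [set: gT])%g|)%N by apply/card_gt0P; exists g0; apply: class_refl.
rewrite (eq_big (mem (g0 ^: [set: gT])%g)
   (fun=> (hnu q (type_part u))%:R / #|(g0 ^: [set: gT])%g|%:R)).
- by rewrite sumr_const -[LHS]mulr_natl mulrCA mulfV ?mulr1 // pnatr_eq0 -lt0n.
- move=> g; rewrite realsetE /= -type_vec_conj g0u eq_sym; case: eqP => [<-|]; rewrite ?andbF //.
  by rewrite ug.
move=> g /andP[_ /eqP gu].
have gg0 : g \in (g0 ^: [set: gT])%g by rewrite -type_vec_conj g0u gu.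
have S0 : (0 < #|(g ^: SL n F)%g|)%N by apply/card_gt0P; exists g; apply: class_refl.
rewrite -(class_eqP gg0) card_conj_class_ratio gu natrM invfM mulVKf //.
have := K0; rewrite -(class_eqP gg0) card_conj_class_ratio gu muln_gt0 => /andP[h0 _].
by rewrite pnatr_eq0 -lt0n.
Qed.

End Reality.

Theorem theorem4p5 (n q : nat) (F : finFieldType)
    (hn : (0 < n)%N) (hF : #|F| = q)
    (hnq : (n %% 4 <> 2)%N \/ (q %% 4 <> 3)%N) :
  (#|real_classes (SL n F)|%:R
     = \sum_(nu : n.-bseq 'I_n.+1 | is_partition n (parts nu))
         (hnu q (parts nu))%:R * slnu q (parts nu) :> rat)%R
  /\ ((n %% 4 <> 2)%N \/ ~~ odd q ->
      #|strongly_real_classes (SL n F)| = #|real_classes (SL n F)|).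
Proof.
subst q; case: n hn hnq => [|m] hn hnq; first by [].
split; last by move=> hs; rewrite strongly_real_classesE // real_classesE.
(* Both sides equal the sum over [realset] of the inverse sizes of the classes in SL_n. *)
rewrite real_classesE // -sum_good -sum_realset.
apply: card_classes_sub => [|x y xX _]; last exact: realsetJ.
by apply/subsetP => g; rewrite inE => /andP[].
Qed.
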